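(* Let $F=F(A)$ be a free group of rank $2$ with free basis $A=\{a_1,a_2\}$, and let $V_1\subseteq F$ be the set of all visible elements of $F$. Then $$\lim_{m\to\infty}\frac{\gamma_A(2m,V_1)}{\gamma_A(2m,F)}=\frac{2}{3\zeta(2)}=\frac{4}{\pi^2}$$ and $$\lim_{m\to\infty}\frac{\gamma_A(2m-1,V_1)}{\gamma_A(2m-1,F)}=\frac{8}{\pi^2}.$$
   Context: Let $\alpha:F\to\mathbb{Z}^2$ be the abelianization homomorphism, $\alpha(a_i)=e_i$. A nonzero point of $\mathbb{Z}^2$ is visible if the greatest common divisor of its coordinates is $1$; an element $w\in F$ is visible if $\alpha(w)$ is visible in $\mathbb{Z}^2$. For $w\in F$, $|w|_A$ is the freely reduced length of $w$ with respect to $A$, and for $X\subseteq F$, $\gamma_A(n,X)=\#\{w\in X:|w|_A=n\}$. $\zeta$ is the Riemann zeta-function. *)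

(* Defs.v *)
From HB Require Import structures.
From mathcomp Require Import all_boot all_order all_algebra.
From mathcomp Require Import finmap all_classical all_reals all_analysis.

Set Implicit Arguments.
Unset Strict Implicit.
Unset Printing Implicit Defensive.

Import Order.TTheory GRing.Theory Num.Theory.
Import numFieldNormedType.Exports.

Local Open Scope classical_set_scope.
Local Open Scope fset_scope.
Local Open Scope ring_scope.

(* The universal property of a free basis a_0, ..., a_(k-1) of F. The members
   of the family are automatically distinct, so F is free of rank k. *)
Definition free_basis (F : groupType) (k : nat) (a : 'I_k -> F) : Prop :=
  forall (G : groupType) (f : 'I_k -> G),
    (exists phi : {multiplicative F -> G}, forall i, phi (a i) = f i) /\
    (forall phi psi : {multiplicative F -> G},
       (forall i, phi (a i) = psi (a i)) -> forall w, phi w = psi w).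

(* (i, true) stands for a_i and (i, false) for its inverse. *)
Definition eval_letter (F : groupType) (k : nat) (a : 'I_k -> F)
    (x : 'I_k * bool) : F :=
  if x.2 then a x.1 else (a x.1)^-1%g.

Definition eval_word (F : groupType) (k : nat) (a : 'I_k -> F)
    (s : seq ('I_k * bool)) : F :=
  (\prod_(x <- s) eval_letter a x)%g.

Definition freely_reduced (k : nat) (s : seq ('I_k * bool)) : bool :=
  sorted (fun x y => y != (x.1, ~~ x.2)) s.

(* When a is a free basis, w is the value of exactly one freely reduced word,
   so xget selects that word and its default value [::] is never used. *)
Definition reduced_word (F : groupType) (k : nat) (a : 'I_k -> F) (w : F) :
    seq ('I_k * bool) :=
  xget [::] [set s | freely_reduced s /\ eval_word a s = w].

Definition reduced_length (F : groupType) (k : nat) (a : 'I_k -> F) (w : F) :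
    nat :=
  size (reduced_word a w).

(* fset_set sends an infinite set to fset0; the sets counted here are finite
   when a is a free basis. *)
Definition gamma_count (F : groupType) (k : nat) (a : 'I_k -> F) (n : nat)
    (X : set F) : nat :=
  #|` fset_set [set w | X w /\ reduced_length a w = n]|.

Definition abelianization (F : groupType) (k : nat) (a : 'I_k -> F)
    (alpha : F -> 'rV[int]_k) : Prop :=
  (forall u v : F, alpha (u * v)%g = alpha u + alpha v) /\
  (forall i, alpha (a i) = delta_mx 0 i).

Definition visible_point (v : 'rV[int]_2) : Prop :=
  v <> 0 /\ gcdz (v 0 0) (v 0 1) = 1.

Definition visible_elements (F : groupType) (alpha : F -> 'rV[int]_2) :
    set F :=
  [set w | visible_point (alpha w)].

(* The Dirichlet series of the Riemann zeta function at a real argument; its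
   value is meaningful only for s > 1. *)
Definition zeta (R : realType) (s : R) : R :=
  limn (series (fun n : nat => n.+1%:R `^ (- s))).

(* Main.v *)
(* Let N_n be the number of reduced words of length n and P_n the uniform
   probability on them, pushed forward to Z^2. Sums of functions over reduced
   words obey the three-term recurrence of the non-backtracking walk, so the
   character sum at (x, y) is S_n with S_(n+1) = T S_n - 3 S_(n-1) and
   T = 2 cos x + 2 cos y; it is exponentially small compared with N_n away from
   the points where |T| = 4. For odd d, Fourier inversion on (Z/d)^2 then gives
   P_n(d divides both coordinates) = d^-2 (1 + O(d^2/n)) as long as d^2 = O(n),
   also after twisting by the parity of the first coordinate.

   A vector in the range of P_n has coordinate sum congruent to n mod 2, so it is
   visible iff no odd prime divides both coordinates and, when n is even, the
   first coordinate is odd; the latter has frequency 1/2. Sieving by the odd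
   primes up to Q gives the limit prod_(p <= Q) (1 - p^-2); the second moment
   E |v|^2 = O(n) bounds |v| by O(sqrt n), so the primes beyond Q contribute O(1/Q)
   uniformly in n. The product over odd primes is the inverse of
   sum_(k odd) k^-2 = pi^2/8, which follows from iterating
   1/sin^2 x = (1/sin^2 (x/2) + 1/cos^2 (x/2)) / 4 from x = pi/2. *)

Require Import Defs.
From HB Require Import structures.
From mathcomp Require Import all_boot all_order all_algebra.
From mathcomp Require Import all_classical all_reals all_analysis.
From mathcomp Require Import finmap zify ring lra.

Set Implicit Arguments.
Unset Strict Implicit.
Unset Printing Implicit Defensive.

Import Order.TTheory GRing.Theory Num.Theory.
Import numFieldNormedType.Exports.

Local Open Scope classical_set_scope.
Local Open Scope ring_scope.

(** * Normal forms in a free group *)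

Section PermutationGroup.
Variable T : Type.

(** The inverse is stored as data, so that the bijections of an infinite type form a [groupType], to
    which the universal property can be applied. *)
Record selfbij := Selfbij {
  bij_fun : T -> T;
  bij_inv : T -> T;
  bij_funK : cancel bij_fun bij_inv;
  bij_invK : cancel bij_inv bij_fun }.

HB.instance Definition _ := gen_eqMixin selfbij.
HB.instance Definition _ := gen_choiceMixin selfbij.

Lemma selfbij_eq (f g : selfbij) : bij_fun f =1 bij_fun g -> f = g.
Proof.
case: f g => [f f' fK f'K] [g g' gK g'K] /= /funext fg; subst g.
have /funext f'g' : f' =1 g' by move=> x; rewrite -[x in f' x]g'K fK.
by subst g'; congr Selfbij; exact: Prop_irrelevance.
Qed.

Definition selfbij1 : selfbij := @Selfbij id id (fun=> erefl) (fun=> erefl).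
Definition selfbijV (f : selfbij) : selfbij :=
  Selfbij (bij_invK f) (bij_funK f).
Definition selfbijM (f g : selfbij) : selfbij :=
  Selfbij (can_comp (bij_funK f) (bij_funK g))
          (can_comp (bij_invK g) (bij_invK f)).

Fact selfbijA : associative selfbijM.
Proof. by move=> f g h; apply: selfbij_eq. Qed.
Fact selfbij1M : left_id selfbij1 selfbijM.
Proof. by move=> f; apply: selfbij_eq. Qed.
Fact selfbijM1 : right_id selfbij1 selfbijM.
Proof. by move=> f; apply: selfbij_eq. Qed.
Fact selfbijVM : left_inverse selfbij1 selfbijV selfbijM.
Proof. by move=> f; apply: selfbij_eq => x /=; rewrite bij_funK. Qed.
Fact selfbijMV : right_inverse selfbij1 selfbijV selfbijM.
Proof. by move=> f; apply: selfbij_eq => x /=; rewrite bij_invK. Qed.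
HB.instance Definition _ :=
  isGroup.Build selfbij selfbijA selfbij1M selfbijM1 selfbijVM selfbijMV.

Lemma bij_funM (f g : selfbij) x : bij_fun (f * g)%g x = bij_fun f (bij_fun g x).
Proof. by []. Qed.

Lemma bij_funV (f : selfbij) : bij_fun (f^-1)%g = bij_inv f.
Proof. by []. Qed.

End PermutationGroup.

Section PredicateSubgroup.
Variables (F : groupType) (P : pred F) (Pg : group_closed P).

Definition subgroup_of of group_closed P := {w | P w}.
HB.instance Definition _ := SubChoice.on (subgroup_of Pg).
HB.instance Definition _ := SubChoice_isSubGroup.Build F P (subgroup_of Pg) Pg.

End PredicateSubgroup.

(** * Reduced words in the free group *)

Section FreeGroup.
Variables (F : groupType) (k : nat) (a : 'I_k -> F).
Hypothesis ha : free_basis a.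

Local Notation letter := ('I_k * bool)%type.

Definition inv_letter (x : letter) : letter := (x.1, ~~ x.2).

Lemma inv_letterK : involutive inv_letter.
Proof. by case=> i b; rewrite /inv_letter /= negbK. Qed.

Lemma eval_inv_letter x : eval_letter a (inv_letter x) = (eval_letter a x)^-1%g.
Proof. by case: x => i [] //=; rewrite /eval_letter /= invgK. Qed.

Lemma eval_word_cons x s : eval_word a (x :: s) = (eval_letter a x * eval_word a s)%g.
Proof. by rewrite /eval_word big_cons. Qed.

Definition prepend (x : letter) (s : seq letter) :=
  if s is y :: s' then if y == inv_letter x then s' else x :: s else [:: x].

Lemma freely_reduced_behead (x : letter) s :
  freely_reduced (x :: s) -> freely_reduced s.
Proof. by case: s => //= y s /andP[]. Qed.

Lemma prepend_reduced x s : freely_reduced s -> freely_reduced (prepend x s).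
Proof.
case: s => //= y s; case: ifPn => [_|yx] ys; first exact: freely_reduced_behead ys.
by rewrite /freely_reduced /= yx.
Qed.

(** If [x] cancels the head of [s], the next letter cannot be [x], because [s] is reduced; so
    prepending the inverse restores the head instead of cancelling again. *)
Lemma prependK x s : freely_reduced s -> prepend (inv_letter x) (prepend x s) = s.
Proof.
case: s => [|y s] /=; first by rewrite inv_letterK eqxx.
case: ifPn => [/eqP ->|yx _] /=; last by rewrite inv_letterK eqxx.
by case: s => //= z s /andP[+ _]; rewrite -/(inv_letter _) => /negPf ->.
Qed.

Lemma eval_prepend x s : eval_word a (prepend x s) = (eval_letter a x * eval_word a s)%g.
Proof.
case: s => [|y s] /=; first by rewrite eval_word_cons.
case: ifPn => [/eqP ->|_]; last by rewrite eval_word_cons.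
by rewrite eval_word_cons eval_inv_letter mulVKg.
Qed.

Local Notation rword := {s : seq letter | freely_reduced s}.

Definition rprepend x (s : rword) : rword :=
  exist (fun s => freely_reduced s) _ (prepend_reduced x (svalP s)).

Lemma rprependK x : cancel (rprepend x) (rprepend (inv_letter x)).
Proof. by case=> s rs; apply/val_inj; rewrite /= prependK. Qed.

Lemma rprependVK x : cancel (rprepend (inv_letter x)) (rprepend x).
Proof. by move=> s; have := rprependK (inv_letter x) s; rewrite inv_letterK. Qed.

Definition letter_bij x := Selfbij (rprependK x) (rprependVK x).

Lemma gmulf_inv (G H : groupType) (f : {multiplicative G -> H}) x :
  f x^-1%g = (f x)^-1%g.
Proof.
have f1 : f 1%g = 1%g by apply: (@mulgI _ (f 1%g)); rewrite -gmulfM !mulg1.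
by apply: (@mulgI _ (f x)); rewrite -gmulfM !mulgV.
Qed.

Lemma gmulf_one (G H : groupType) (f : {multiplicative G -> H}) : f 1%g = 1%g.
Proof. by apply: (@mulgI _ (f 1%g)); rewrite -gmulfM !mulg1. Qed.

(* The permutations "prepend a letter and reduce" of the set of reduced words
   extend to F; the image of a reduced word s maps the empty word to s. *)
Lemma eval_word_inj s t : freely_reduced s -> freely_reduced t ->
  eval_word a s = eval_word a t -> s = t.
Proof.
have [[phi phia] _] := ha (fun i => letter_bij (i, true)).
have phil x : phi (eval_letter a x) = letter_bij x.
  case: x => i [] /=; rewrite /eval_letter /= ?gmulf_inv phia //.
  apply: selfbij_eq => r; rewrite bij_funV /=; apply/val_inj => /=.
  by rewrite /inv_letter.
suff key u : freely_reduced u ->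
    sval (bij_fun (phi (eval_word a u)) (exist (fun s => freely_reduced s) [::] isT)) = u.
  by move=> rs rt est; rewrite -(key s rs) est (key t rt).
elim: u => [|x u IH] ru; first by rewrite /eval_word big_nil gmulf_one.
rewrite eval_word_cons gmulfM bij_funM phil /= IH; last exact: freely_reduced_behead ru.
case: u ru {IH} => //= y u /andP[+ _].
by rewrite -/(inv_letter _) => /negPf ->.
Qed.

(** The homomorphism to the subgroup that fixes the basis, followed by the inclusion, agrees with
    the identity on the basis, hence everywhere. *)
Lemma free_basis_generates (P : pred F) : group_closed P ->
  (forall i, P (a i)) -> forall w, P w.
Proof.
move=> Pg Pa w.
have [[phi phia] _] := ha (fun i => Sub (a i) (Pa i) : subgroup_of Pg).
have psiM : {morph (fun w => val (phi w)) : x y / (x * y)%g}.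
  by move=> x y; rewrite gmulfM valM.
pose psi : {multiplicative F -> F} := HB.pack (fun w => val (phi w))
  (isMultiplicative.Build F F _ psiM).
have idM : {morph (@id F) : x y / (x * y)%g} by [].
pose idm : {multiplicative F -> F} := HB.pack (@id F)
  (isMultiplicative.Build F F _ idM).
have [_ /(_ psi idm) uniq_hom] := ha a.
rewrite -[w]/(idm w) -uniq_hom; first exact: valP.
by move=> i; rewrite /= phia SubK.
Qed.

Lemma eval_word_cat s t :
  eval_word a (s ++ t) = (eval_word a s * eval_word a t)%g.
Proof. by rewrite /eval_word big_cat. Qed.

(** The values of words form a subgroup containing the basis; rebuilding a word with [prepend],
    letter by letter, makes it reduced and keeps its value. *)
Lemma eval_word_surj w : exists2 s, freely_reduced s & eval_word a s = w.
Proof.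
pose P w := `[< exists s, eval_word a s = w >].
have evalV s : exists t, eval_word a t = (eval_word a s)^-1%g.
  exists (rev (map inv_letter s)); elim: s => [|x s IH].
    by rewrite /eval_word !big_nil invg1.
  rewrite /= rev_cons -cats1 eval_word_cat IH !eval_word_cons eval_inv_letter.
  by rewrite [X in (_ * (_ * X))%g]big_nil mulg1 invgM.
have Pg : group_closed P.
  split; first by apply/asboolP; exists [::]; rewrite /eval_word big_nil.
  move=> u v /asboolP[s <-] /asboolP[t <-]; apply/asboolP.
  by have [t' <-] := evalV t; exists (s ++ t'); rewrite eval_word_cat.
have Pa i : P (a i).
  apply/asboolP; exists [:: (i, true)].
  by rewrite eval_word_cons /eval_word big_nil mulg1.
have /asboolP[s <-] := free_basis_generates Pg Pa w.
elim: s => [|x s [t rt et]]; first by exists [::].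
exists (prepend x t); first exact: prepend_reduced.
by rewrite eval_prepend et eval_word_cons.
Qed.

Lemma reduced_wordP w :
  freely_reduced (reduced_word a w) /\ eval_word a (reduced_word a w) = w.
Proof.
have [s rs es] := eval_word_surj w.
exact: (@xgetI _ [::] [set s | freely_reduced s /\ eval_word a s = w] s).
Qed.

Lemma reduced_word_eval s : freely_reduced s ->
  reduced_word a (eval_word a s) = s.
Proof.
by move=> rs; have [r e] := reduced_wordP (eval_word a s); exact: eval_word_inj e.
Qed.

Lemma gamma_countE n (X : set F) (r : seq (seq letter)) : uniq r ->
  (forall s, (s \in r) = freely_reduced s && (size s == n)) ->
  gamma_count a n X = count (fun s => `[< X (eval_word a s) >]) r.
Proof.
move=> ur rP; rewrite /gamma_count.
pose L := [seq eval_word a s | s <- r & `[< X (eval_word a s) >]].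
have -> : [set w | X w /\ reduced_length a w = n] = [set` L].
  apply/seteqP; split => w /=.
    move=> [Xw ln]; have [rw ew] := reduced_wordP w.
    apply/mapP; exists (reduced_word a w); last by rewrite ew.
    rewrite mem_filter ew rP rw -ln eqxx !andbT.
    exact/asboolP.
  move=> /mapP[s]; rewrite mem_filter rP => /andP[/asboolP Xs /andP[rs /eqP ss]] ->.
  by split=> //; rewrite /reduced_length reduced_word_eval.
have -> : [set` L] = [set` [fset w in L]%fset].
  by apply/seteqP; split => w /=; rewrite !inE.
rewrite set_fsetK card_fseq undup_id ?size_map ?size_filter //.
rewrite map_inj_in_uniq ?filter_uniq // => s t.
rewrite !mem_filter !rP => /andP[_ /andP[rs _]] /andP[_ /andP[rt _]].
exact: eval_word_inj.
Qed.

End FreeGroup.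

(** * The recurrence of the non-backtracking walk *)

Section Recurrence.
Variable R : realFieldType.
Implicit Types (T : R) (S : nat -> R).

(** Here the roots of z^2 - T z + 3 are real. The ratio r of consecutive terms evolves by r -> T - 3
    / r, which preserves the interval [T / 2, T - 1]: the lower end by T^2 >= 12, the upper end by T
    <= 4. *)
Lemma ratio_bound T S : 0 <= T -> 12 <= T ^+ 2 -> T <= 4 ->
  S 1%N = T -> S 2 = T ^+ 2 - 4 ->
  (forall n, S n.+3 = T * S n.+2 - 3 * S n.+1) ->
  forall n, [/\ 0 < S n.+1, T / 2 * S n.+1 <= S n.+2, S n.+2 <= (T - 1) * S n.+1
    & S n.+1 <= T * (T - 1) ^+ n].
Proof.
move=> T0 T12 T4 S1 S2 SS.
have T3 : 3 <= T by nra.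
elim=> [|n [Sn0 lb ub pb]].
  by rewrite S1 S2 expr0; split; nra.
have S2_gt0 : 0 < S n.+2 by nra.
rewrite SS; split => //; [by nra|by nra|].
rewrite exprS; apply: (le_trans ub).
have := ler_wpM2l (_ : 0 <= T - 1) pb; rewrite mulrCA; apply; lra.
Qed.

(** Here the roots are complex or double. The quadratic form [E] is multiplied by 3 at each step;
    completing the square bounds S_(n+2) - (T/2) S_(n+1), and |T/2| <= sqrt 3 < 7/4. *)
Lemma oscillating_bound T S : T ^+ 2 <= 12 ->
  S 1%N = T -> S 2 = T ^+ 2 - 4 ->
  (forall n, S n.+3 = T * S n.+2 - 3 * S n.+1) ->
  forall n, `|S n.+1| <= 16 * 2 ^+ n.
Proof.
move=> T12 S1 S2 SS.
pose E n := S n.+2 ^+ 2 - T * S n.+1 * S n.+2 + 3 * S n.+1 ^+ 2.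
have EE n : E n = 3 ^+ n * (16 - T ^+ 2).
  elim: n => [|n IH]; first by rewrite /E S1 S2 expr0; ring.
  by rewrite exprS -mulrA -IH /E SS; ring.
have Tle : `|T / 2| <= 7 / 4 by rewrite ler_norml; apply/andP; split; nra.
have step n : `|S n.+2 - T / 2 * S n.+1| <= 4 * (7 / 4) ^+ n.
  have c0 : 0 <= 4 * (7 / 4) ^+ n :> R by rewrite mulr_ge0 // exprn_ge0 //; lra.
  rewrite -(ler_pXn2r (_ : 0 < 2)%N) ?nnegrE // -normrX ger0_norm ?sqr_ge0 //.
  have -> : (S n.+2 - T / 2 * S n.+1) ^+ 2 = E n - (12 - T ^+ 2) / 4 * S n.+1 ^+ 2.
    by rewrite /E; field.
  have /le_trans -> // : E n - (12 - T ^+ 2) / 4 * S n.+1 ^+ 2 <= E n.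
    by rewrite gerBl mulr_ge0 ?sqr_ge0 //; lra.
  rewrite EE exprMn -exprM mulnC exprM mulrC ler_pM ?exprn_ge0 //; try nra.
  by rewrite lerXn2r ?nnegrE //; lra.
(* The constant 16 reproduces itself because 7/4 * 16 + 4 = 2 * 16. *)
elim=> [|n IH]; first by rewrite S1 expr0 ler_norml; apply/andP; split; nra.
rewrite -[S n.+2](subrK (T / 2 * S n.+1)).
apply: (le_trans (ler_normD _ _)).
have pow : (7 / 4) ^+ n <= 2 ^+ n :> R by rewrite lerXn2r ?nnegrE //; lra.
have mulT : `|T / 2 * S n.+1| <= 7 / 4 * (16 * 2 ^+ n).
  by rewrite normrM ler_pM.
by have := step n; rewrite exprS; lra.
Qed.

(** Both growth rates, 2 and |T| - 1, are at most (8 + |T|) / 4 when |T| <= 4. Relative to 3 this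
    rate is below 1 unless |T| = 4. Negative T reduces to positive T by alternating the signs of
    [S]. *)
Lemma recurrence_bound T S : `|T| <= 4 ->
  S 1%N = T -> S 2 = T ^+ 2 - 4 ->
  (forall n, S n.+3 = T * S n.+2 - 3 * S n.+1) ->
  forall n, `|S n.+1| <= 16 * 3 ^+ n * ((8 + `|T|) / 12) ^+ n.
Proof.
move=> T4 S1 S2 SS n.
have [T12|T12] := leP (T ^+ 2) 12.
  apply: (le_trans (oscillating_bound T12 S1 S2 SS n)).
  rewrite -mulrA ler_pM2l // -exprMn lerXn2r ?nnegrE //; have := normr_ge0 T; lra.
have [T0|T0] := leP 0 T.
  have T4' : T <= 4 by rewrite -(ger0_norm T0).
  have [Sn _ _ ub] := ratio_bound T0 (ltW T12) T4' S1 S2 SS n.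
  rewrite (gtr0_norm Sn) (ger0_norm T0) (le_trans ub) //.
  rewrite -mulrA -exprMn ler_pM ?exprn_ge0 //; try nra.
  by rewrite lerXn2r ?nnegrE //; nra.
have T4' : - T <= 4 by rewrite -(ltr0_norm T0).
have T12' : 12 <= (- T) ^+ 2 by rewrite sqrrN ltW.
have NT0 : 0 <= - T by lra.
pose S' n := (- 1) ^+ n * S n.
have S'1 : S' 1%N = - T by rewrite /S' S1; ring.
have S'2 : S' 2 = (- T) ^+ 2 - 4 by rewrite /S' S2; ring.
have S'S n' : S' n'.+3 = (- T) * S' n'.+2 - 3 * S' n'.+1.
  by rewrite /S' SS !exprS; ring.
have [Sn _ _ ub] := ratio_bound NT0 T12' T4' S'1 S'2 S'S n.
have -> : `|S n.+1| = `|S' n.+1| by rewrite normrM normrX normrN1 expr1n mul1r.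
rewrite (gtr0_norm Sn) (ltr0_norm T0) (le_trans ub) //.
rewrite -mulrA -exprMn ler_pM ?exprn_ge0 //; try nra.
by rewrite lerXn2r ?nnegrE //; nra.
Qed.

End Recurrence.

(** * Sums over reduced words *)

Section WordSums.
Variable k : nat.
Local Notation letter := ('I_k * bool)%type.

Definition can_prepend (x : letter) (s : seq letter) :=
  if s is y :: _ then y != inv_letter x else true.

Lemma freely_reduced_cons (x : letter) s :
  freely_reduced (x :: s) = can_prepend x s && freely_reduced s.
Proof. by case: s. Qed.

Fixpoint reduced_words (n : nat) : seq (seq letter) :=
  if n is m.+1 then
    [seq x :: s | x <- enum {: letter},
                  s <- [seq s <- reduced_words m | can_prepend x s]]
  else [:: [::]].

Lemma mem_reduced_words n s :
  (s \in reduced_words n) = freely_reduced s && (size s == n).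
Proof.
elim: n s => [|n IH] s /=; first by rewrite inE; case: s => //= x s; rewrite andbF.
apply/allpairsPdep/idP => [[x [t [_ ]]]|].
  rewrite mem_filter IH => /andP[xt /andP[rt /eqP st]] ->.
  by rewrite freely_reduced_cons xt rt /= st.
case: s => [|x s]; first by rewrite andbF.
rewrite freely_reduced_cons /= eqSS => /andP[/andP[xs rs] ss].
by exists x, s; split; rewrite ?mem_enum // mem_filter xs IH rs.
Qed.

Lemma reduced_words_uniq n : uniq (reduced_words n).
Proof.
elim: n => //= n IH; apply: allpairs_uniq_dep => /=.
- exact: enum_uniq.
- by move=> x _; rewrite filter_uniq.
- by move=> [x s] [y t] _ _ /= [-> ->].
Qed.

Variables (R : pzRingType) (V : zmodType) (v : letter -> V).
Hypothesis vN : forall x, v (inv_letter x) = - v x.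
Implicit Types f : V -> R.

Definition position (s : seq letter) : V := \sum_(x <- s) v x.

Lemma position_cons x s : position (x :: s) = v x + position s.
Proof. exact: big_cons. Qed.

Definition word_sum n f : R := \sum_(s <- reduced_words n) f (position s).

(** The adjacency operator of the walk with steps [v], backtracking allowed. *)
Definition neighbour_sum f (p : V) : R := \sum_x f (v x + p).

Lemma word_sum0 f : word_sum 0 f = f 0.
Proof. by rewrite /word_sum big_seq1 /position big_nil. Qed.

Lemma word_sumS n f : word_sum n.+1 f =
  \sum_x \sum_(s <- reduced_words n | can_prepend x s) f (v x + position s).
Proof.
rewrite /word_sum big_allpairs_dep /= big_enum /=; apply: eq_bigr => x _.
by rewrite big_filter; apply: eq_bigr => s _; rewrite position_cons.
Qed.

Lemma word_sum1 f : word_sum 1 f = neighbour_sum f 0.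
Proof.
rewrite word_sumS; apply: eq_bigr => x _.
by rewrite big_cons /= big_nil addr0 /position big_nil.
Qed.

Lemma card_can_prepend s :
  #|[pred x | can_prepend (inv_letter x) s]| = ((2 * k) - (s != [::]))%N.
Proof.
case: s => [|y s] /=.
  by rewrite subn0 (eq_card (B := predT)) ?card_prod ?card_ord ?card_bool 1?mulnC.
rewrite (eq_card (B := predC1 y)).
  by rewrite cardC1 card_prod card_ord card_bool mulnC subn1.
by move=> x; rewrite !inE inv_letterK eq_sym.
Qed.

(* Prepending an arbitrary letter to a reduced word of length n+1 either gives a
   reduced word of length n+2 or cancels, leaving a reduced word of length n. *)
Lemma word_sum_rec n f : word_sum n.+2 f =
  word_sum n.+1 (neighbour_sum f) - word_sum n f *+ (2 * k - (n != 0))%N.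
Proof.
apply/eqP; rewrite eq_sym subr_eq; apply/eqP.
rewrite (word_sumS n.+1) {1}/word_sum /neighbour_sum exchange_big /=.
under eq_bigr => x _ do
  rewrite (bigID (can_prepend x)) /=.
rewrite big_split /=; congr (_ + _).
have cancelE x :
    \sum_(s <- reduced_words n.+1 | ~~ can_prepend x s) f (v x + position s) =
    \sum_(s <- reduced_words n | can_prepend (inv_letter x) s) f (position s).
  rewrite /= big_mkcond big_allpairs_dep big_enum /= (bigD1 (inv_letter x)) //=.
  rewrite big_filter [X in _ + X]big1 ?addr0 => [|y /negPf yx].
    rewrite eqxx /=; apply: eq_bigr => s _.
    by rewrite position_cons vN addNKr.
  by rewrite big_filter big1 // => s _; rewrite yx.
under eq_bigr do rewrite cancelE.
under eq_bigr => x _ do rewrite big_mkcond.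
rewrite exchange_big /= /word_sum -sumrMnl big_seq [RHS]big_seq.
apply: eq_bigr => s; rewrite mem_reduced_words => /andP[_ /eqP ss].
by rewrite -big_mkcond sumr_const card_can_prepend -size_eq0 ss.
Qed.

End WordSums.

(** * The walk on the plane *)

Section PlaneWalk.
Variable R : realType.
Implicit Types (f g : int * int -> R) (x y : R).

Definition letter_vector (x : 'I_2 * bool) : int * int :=
  let e : int := if x.2 then 1 else -1 in if x.1 == ord0 then (e, 0) else (0, e).

Lemma letter_vectorN (x : 'I_2 * bool) : letter_vector (inv_letter x) = - letter_vector x.
Proof. by case: x => i b; rewrite /letter_vector /=; case: (i == ord0); case: b. Qed.

Lemma big_letter (F : 'I_2 * bool -> R) : \sum_x F x =
  F (ord0, true) + F (ord0, false) + (F (ord_max, true) + F (ord_max, false)).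
Proof.
rewrite (eq_bigr (fun p => F (p.1, p.2))) => [|[]//].
rewrite -(pair_bigA _ (fun i b => F (i, b))) /= big_ord_recl big_ord1 !big_bool.
by congr (_ + (F (_, _) + F (_, _))); apply/val_inj.
Qed.

Lemma neighbour_sum2E f p : neighbour_sum letter_vector f p =
  f (1 + p.1, p.2) + f (-1 + p.1, p.2) + (f (p.1, 1 + p.2) + f (p.1, -1 + p.2)).
Proof.
case: p => p q; rewrite /neighbour_sum big_letter /letter_vector /=.
have pairD (i j i' j' : int) : (i, j) + (i', j') = (i + i', j + j') by [].
by rewrite !pairD !add0r.
Qed.

Local Notation W := (word_sum letter_vector).

Lemma word_sumZ n c f : W n (fun p => c * f p) = c * W n f.
Proof. by rewrite /word_sum mulr_sumr. Qed.

Lemma eq_word_sum n f g : f =1 g -> W n f = W n g.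
Proof. by move=> fg; apply: eq_bigr => s _. Qed.

(** On an eigenfunction [word_sum_rec] becomes a scalar recurrence. A nonempty word arises by
    cancellation in 3 ways, the empty one in 4, whence the separate value at length 2. *)
Lemma word_sum_eigen T f : (forall p, neighbour_sum letter_vector f p = T * f p) ->
  f 0 = 1 ->
  [/\ W 1 f = T, W 2 f = T ^+ 2 - 4
    & forall n, W n.+3 f = T * W n.+2 f - 3 * W n.+1 f].
Proof.
move=> fT f0; have W1 : W 1 f = T by rewrite word_sum1 fT f0 mulr1.
split => // [|n].
  rewrite (word_sum_rec letter_vectorN).
  rewrite word_sum0 f0 (eq_word_sum _ fT) word_sumZ W1 expr2.
  by congr (_ - _).
rewrite (word_sum_rec letter_vectorN).
by rewrite (eq_word_sum _ fT) word_sumZ -[X in _ - X]mulr_natl.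
Qed.

(** The average of the character of frequency (x, y) over sign changes of x and y; it is real, and
    still an eigenfunction since the set of steps is symmetric. *)
Definition wave x y (p : int * int) : R := cos (p.1%:~R * x) * cos (p.2%:~R * y).

Lemma wave_eigen x y p :
  neighbour_sum letter_vector (wave x y) p = (2 * cos x + 2 * cos y) * wave x y p.
Proof.
rewrite neighbour_sum2E /wave /= !intrD !mulrDl !mulN1r !mul1r !cosD !cosN !sinN.
ring.
Qed.

(** For T = 2 cos x + 2 cos y, the rate (8 + |T|) / 12 is at most [damping x * damping y]; the
    product form lets double sums over frequencies factor. *)
Definition damping x := 1 - sin x ^+ 2 / 12.

Lemma damping_bounds x : 0 <= damping x <= 1.
Proof.
by rewrite /damping sin2cos2; have := sqr_ge0 (sin x); have := sqr_ge0 (cos x);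
  rewrite sin2cos2 => *; apply/andP; split; lra.
Qed.

Lemma norm_cos_le x : `|cos x| <= 1 - sin x ^+ 2 / 2.
Proof.
have := cos2Dsin2 x; have := sqr_ge0 (cos x); have := sqr_ge0 (sin x).
by rewrite ler_norml => *; apply/andP; split; nra.
Qed.

Lemma wave_bound x y n :
  `|W n.+1 (wave x y)| <= 16 * 3 ^+ n * (damping x ^+ n * damping y ^+ n).
Proof.
have w0 : wave x y 0 = 1 by rewrite /wave /= !mul0r cos0 mulr1.
have [W1 W2 WS] := word_sum_eigen (wave_eigen x y) w0.
have hT : `|2 * cos x + 2 * cos y| <= 4 - sin x ^+ 2 - sin y ^+ 2.
  apply: (le_trans (ler_normD _ _)); rewrite !normrM ger0_norm //.
  by have := norm_cos_le x; have := norm_cos_le y; lra.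
have sx := sqr_ge0 (sin x); have sy := sqr_ge0 (sin y).
have := recurrence_bound (S := fun n => W n (wave x y))
    (_ : `|2 * cos x + 2 * cos y| <= 4) W1 W2 WS n.
rewrite (le_trans hT) => [/(_ isT) /le_trans -> //|]; last by lra.
rewrite ler_pM2l ?mulr_gt0 ?exprn_gt0 // -exprMn lerXn2r ?nnegrE //.
- by have /andP[? _] := damping_bounds x; have /andP[? _] := damping_bounds y; rewrite mulr_ge0.
- by have := mulr_ge0 sx sy; rewrite /damping mulrBl mulrBr; lra.
Qed.

(** The index is shifted by one: this averages over the 4 * 3^n reduced words of length [n.+1]. *)
Definition word_mean n f := W n.+1 f / (4 * 3 ^+ n).

Lemma word_sum_const1 n : W n.+1 (fun=> 1 : R) = 4 * 3 ^+ n.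
Proof.
have [W1 W2 WS] : [/\ W 1 (fun=> 1 : R) = 4, W 2 (fun=> 1 : R) = 4 ^+ 2 - 4 :> R
    & forall n, W n.+3 (fun=> 1 : R) = 4 * W n.+2 (fun=> 1 : R) - 3 * W n.+1 (fun=> 1 : R) :> R].
  by apply: word_sum_eigen => // p; rewrite neighbour_sum2E; ring.
suff : W n.+1 (fun=> 1 : R) = 4 * 3 ^+ n /\ W n.+2 (fun=> 1 : R) = 4 * 3 ^+ n.+1 :> R by case.
elim: n => [|n [IH1 IH2]]; first by rewrite W1 W2 expr0 expr1; split; ring.
by split => //; rewrite WS IH1 IH2 !exprS; ring.
Qed.

Let mean_gt0 n : 0 < 4 * 3 ^+ n :> R. Proof. by rewrite mulr_gt0 // exprn_gt0. Qed.

Lemma word_mean_le n f g : (forall p, f p <= g p) -> word_mean n f <= word_mean n g.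
Proof.
by move=> fg; rewrite ler_pM2r ?invr_gt0 //; apply: ler_sum => s _; exact: fg.
Qed.

Lemma eq_word_mean n f g : f =1 g -> word_mean n f = word_mean n g.
Proof. by move=> fg; rewrite /word_mean (eq_word_sum _ fg). Qed.

Lemma word_meanZ n c f : word_mean n (fun p => c * f p) = c * word_mean n f.
Proof. by rewrite /word_mean word_sumZ mulrA. Qed.

Lemma word_mean_sum n (I : Type) (r : seq I) (F : I -> int * int -> R) :
  word_mean n (fun p => \sum_(i <- r) F i p) = \sum_(i <- r) word_mean n (F i).
Proof. by rewrite /word_mean /word_sum exchange_big /= mulr_suml. Qed.

Lemma word_meanD n f g :
  word_mean n (fun p => f p + g p) = word_mean n f + word_mean n g.
Proof. by rewrite /word_mean /word_sum big_split /= mulrDl. Qed.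

Lemma word_meanB n f g :
  word_mean n (fun p => f p - g p) = word_mean n f - word_mean n g.
Proof. by rewrite /word_mean /word_sum sumrB mulrBl. Qed.

Lemma word_mean1 n : word_mean n (fun=> 1) = 1.
Proof. by rewrite /word_mean word_sum_const1 divff ?gt_eqF. Qed.

Lemma word_mean_wave x y n :
  `|word_mean n (wave x y)| <= 4 * (damping x ^+ n * damping y ^+ n).
Proof.
rewrite normrM normfV (gtr0_norm (mean_gt0 n)) ler_pdivrMr //.
by apply: (le_trans (wave_bound x y n)); rewrite le_eqVlt; apply/orP; left; apply/eqP; ring.
Qed.

Definition sqnorm (p : int * int) : R := p.1%:~R ^+ 2 + p.2%:~R ^+ 2.

(** The adjacency operator sends [sqnorm] to [4 * sqnorm + 4], which closes the recurrence for the
    second moment. *)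
Lemma word_mean_sqnorm n : word_mean n sqnorm <= 2 * n.+1%:R.
Proof.
rewrite ler_pdivrMr //.
have W1 : W 1 sqnorm = 4.
  by rewrite word_sum1 neighbour_sum2E /sqnorm /= !addr0 !mulr0z; ring.
have nb p : neighbour_sum letter_vector sqnorm p = 4 * sqnorm p + 4 * 1.
  by rewrite neighbour_sum2E /sqnorm /= !intrD; ring.
have WE n' : W n'.+1 (neighbour_sum letter_vector sqnorm) = 4 * W n'.+1 sqnorm + 16 * 3 ^+ n'.
  rewrite (eq_word_sum _ nb) /word_sum big_split /= -!mulr_sumr.
  by rewrite -/(W n'.+1 (fun=> 1 : R)) word_sum_const1; ring.
have W2 : W 2 sqnorm = 4 * W 1 sqnorm + 16.
  rewrite (word_sum_rec letter_vectorN) WE word_sum0.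
  by rewrite /sqnorm /= mulr0z expr0; ring.
have WS n' : W n'.+3 sqnorm = 4 * W n'.+2 sqnorm + 16 * 3 ^+ n'.+1 - 3 * W n'.+1 sqnorm.
  by rewrite (word_sum_rec letter_vectorN) WE -[X in _ - X]mulr_natl.
(* By the recurrence the increment is multiplied by 3 and raised by 16 * 3^(n+1), hence the joint
   induction with a bound on the increment. *)
suff : W n.+1 sqnorm <= 2 * n.+1%:R * (4 * 3 ^+ n) /\
  W n.+2 sqnorm - W n.+1 sqnorm <= 16 * n.+2%:R * 3 ^+ n by case.
elim: n => [|n [IH1 IH2]].
  by rewrite W2 W1 expr0; split; lra.
have p3 : 0 < 3 ^+ n :> R by rewrite exprn_gt0.
have nu0 : 0 <= n%:R * 3 ^+ n :> R by rewrite mulr_ge0 // ltW.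
have e3 : n.+3%:R = n%:R + 3 :> R by rewrite -natrD addn3.
have e2 : n.+2%:R = n%:R + 2 :> R by rewrite -natrD addn2.
have e1 : n.+1%:R = n%:R + 1 :> R by rewrite natr1.
rewrite WS; move: IH1 IH2; rewrite !exprS e1 e2 e3.
by split; lra.
Qed.

End PlaneWalk.

(** * Estimates for the sine *)

Section SineEstimates.
Variable R : realType.
Implicit Types (x : R).

Lemma sin_mvt x : 0 <= x <= pi -> x * cos x <= sin x <= x.
Proof.
move=> /andP[x0 xpi].
have [|c] := @MVT_segment _ (@sin R) (@cos R) 0 x x0 (fun y _ => is_derive_sin y).
  by apply: continuous_subspaceT => y; exact: continuous_sin.
rewrite in_itv /= sin0 !subr0 => /andP[c0 cx] ->.
rewrite mulrC ler_wpM2r //=; first by rewrite ler_piMl // cos_le1.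
have := cx; rewrite le_eqVlt => /predU1P[->|cx'] //; apply: ltW.
by rewrite ltr_cos // in_itv /= ?x0 ?c0 //= (le_trans cx).
Qed.

(** By half angles, sin x = 2 sin (x/2) cos (x/2) >= x cos^2 (x/2) = x (1 + cos x) / 2. *)
Lemma sin_ge_half x : 0 <= x <= pi / 2 -> x / 2 <= sin x.
Proof.
move=> /andP[x0 xpi].
have cx : 0 <= cos x.
  by apply: cos_ge0_pihalf; rewrite xpi andbT; have := pi_gt0 R; lra.
have /sin_mvt/andP[h _] : 0 <= x / 2 <= pi by apply/andP; split; have := pi_gt0 R; lra.
have xE : x = (x / 2) *+ 2 by rewrite mulr2n; field.
have c2 : cos x = cos (x / 2) ^+ 2 *+ 2 - 1 by rewrite {1}xE cos_mulr2n.
have c0 : 0 <= cos (x / 2).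
  by apply: cos_ge0_pihalf; apply/andP; split; have := pi_gt0 R; lra.
rewrite [X in _ <= sin X]xE sin_mulr2n.
have := ler_wpM2l c0 h; have := mulr_ge0 x0 cx; rewrite c2.
by move: (sin _) (cos _) => s c; lra.
Qed.

Lemma sum_inv_sqr_le m n : (0 < m)%N ->
  \sum_(m.+1 <= k < n) (k%:R ^+ 2)^-1 <= m%:R^-1 :> R.
Proof.
rewrite big_add1 /=; move: n.-1 => {}n m0;
    have [nm|mn] := leqP n m; first by rewrite big_geq // invr_ge0.
suff : \sum_(m <= k < n) (k.+1%:R ^+ 2)^-1 <= m%:R^-1 - n%:R^-1 :> R.
  by move=> /le_trans; apply; rewrite gerBl invr_ge0.
have -> : m%:R^-1 - n%:R^-1 = \sum_(m <= k < n) (- k.+1%:R^-1 - (- k%:R^-1)) :> R.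
  by rewrite (telescope_sumr (fun k => - k%:R^-1)) ?(ltnW mn) // opprK addrC.
apply: ler_sum_nat => k /andP[mk _].
have k0 : 0 < k%:R :> R by rewrite ltr0n (leq_trans m0).
have k1 : 0 < k.+1%:R :> R by rewrite ltr0n.
rewrite opprK addrC -subr_ge0.
have -> : k%:R^-1 - k.+1%:R^-1 - (k.+1%:R ^+ 2)^-1 = (k%:R * k.+1%:R ^+ 2)^-1 :> R.
  by move: k0 k1; rewrite -natr1 => k0 k1; field; rewrite !gt_eqF.
by rewrite invr_ge0 mulr_ge0 ?ltW ?exprn_gt0.
Qed.

(** The bound is symmetric under k -> d - k, which leaves the case 2k <= d, where sin (pi k / d) >=
    pi k / (2d) >= k / d. *)
Lemma inv_sin2_le (d k : nat) : (0 < k < d)%N ->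
  (sin (pi * k%:R / d%:R) ^+ 2)^-1 <=
    d%:R ^+ 2 * ((k%:R ^+ 2)^-1 + ((d - k)%:R ^+ 2)^-1) :> R.
Proof.
wlog kd2 : k / (2 * k <= d)%N => [hw|] /andP[k0 kd].
  have [kd2|dk2] := leqP (2 * k) d; first by apply: hw => //; rewrite k0.
  have := hw (d - k)%N _ _; rewrite subKn ?(ltnW kd) // [(_ ^+ 2)^-1 + _]addrC.
  have d0 : d%:R != 0 :> R by rewrite pnatr_eq0; lia.
  have -> : pi * (d - k)%:R / d%:R = pi - pi * k%:R / d%:R :> R.
    by rewrite natrB ?(ltnW kd) //; field.
  by rewrite sinB sinpi cospi mul0r sub0r mulN1r opprK; apply; lia.
have d0 : 0 < d%:R :> R by rewrite ltr0n; lia.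
have k0' : 0 < k%:R :> R by rewrite ltr0n.
have kd' : 2 * k%:R <= d%:R :> R by rewrite -natrM ler_nat.
have x0 : 0 < k%:R / d%:R :> R by rewrite divr_gt0.
have sin_ge : k%:R / d%:R <= sin (pi * k%:R / d%:R) :> R.
  apply: (@le_trans _ _ (pi * k%:R / d%:R / 2)).
    by have := pi_ge2 R; rewrite -mulrA; nra.
  apply: sin_ge_half; rewrite -mulrA mulr_ge0 ?pi_ge0 ?(ltW x0) //=.
  by rewrite ler_pM2l ?pi_gt0 // ler_pdivrMr // ler_pdivlMl.
apply: (@le_trans _ _ ((k%:R / d%:R) ^+ 2)^-1).
  rewrite lef_pV2 ?posrE ?exprn_gt0 ?(lt_le_trans x0) //.
  by rewrite lerXn2r ?nnegrE ?(le_trans _ sin_ge) ?(ltW x0).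
rewrite expr_div_n invf_div ler_pM2l ?exprn_gt0 // lerDl invr_ge0 sqr_ge0 //.
Qed.

Lemma sum_inv_sin2_le (d : nat) :
  \sum_(1 <= k < d) (sin (pi * k%:R / d%:R) ^+ 2)^-1 <= 4 * d%:R ^+ 2 :> R.
Proof.
have sum2 : \sum_(1 <= k < d) (k%:R ^+ 2)^-1 <= 2 :> R.
  have [d1|d1] := leqP d 1; first by rewrite big_geq.
  rewrite big_ltn // expr1n invr1.
  by have := @sum_inv_sqr_le 1 d isT; rewrite invr1; lra.
apply: (@le_trans _ _ (d%:R ^+ 2 * (2 + 2))); last by rewrite mulrC ler_wpM2r ?sqr_ge0 //; lra.
apply: (@le_trans _ _ (\sum_(1 <= k < d)
    d%:R ^+ 2 * ((k%:R ^+ 2)^-1 + ((d - k)%:R ^+ 2)^-1))).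
  by apply: ler_sum_nat => k kd; exact: inv_sin2_le.
rewrite -mulr_sumr ler_wpM2l ?sqr_ge0 // big_split /= lerD //.
rewrite big_nat_rev /= (eq_big_nat _ _ (F2 := fun k => (k%:R ^+ 2)^-1)) // => k kd.
by congr ((_ %:R ^+ 2)^-1); lia.
Qed.

(** By induction, as (1 - x) (1 + (n+1) x) <= 1 + n x. *)
Lemma expr_onem_le (x : R) n : 0 <= x <= 1 -> (1 - x) ^+ n * (1 + n%:R * x) <= 1.
Proof.
move=> /andP[x0 x1]; elim: n => [|n IH]; first by rewrite expr0 !mul1r mul0r addr0.
apply: le_trans IH; rewrite exprSr -mulrA ler_wpM2l ?exprn_ge0 ?subr_ge0 //.
have : 0 <= n%:R * x ^+ 2 by rewrite mulr_ge0 ?sqr_ge0.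
by have := sqr_ge0 x; rewrite -natr1 !expr2; lra.
Qed.

Lemma damping_pow_le x n : (0 < n)%N -> sin x != 0 ->
  damping x ^+ n <= 12 / n%:R * (sin x ^+ 2)^-1.
Proof.
move=> n0 sx0; have s0 : 0 < sin x ^+ 2 by rewrite exprn_even_gt0.
have n0' : 0 < n%:R :> R by rewrite ltr0n.
have s1 : sin x ^+ 2 <= 1 by rewrite sin2cos2 gerBl sqr_ge0.
have h : damping x ^+ n * (1 + n%:R * (sin x ^+ 2 / 12)) <= 1.
  by apply: expr_onem_le; apply/andP; split; lra.
rewrite -mulrA -invfM ler_pdivlMr; last by rewrite mulr_gt0.
have /andP[dx _] := damping_bounds x.
have : 0 <= damping x ^+ n by rewrite exprn_ge0.
by move: h; rewrite mulrDr mulr1; lra.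
Qed.

End SineEstimates.

(** * Divisibility by odd numbers *)

Section Characters.
Variable R : realType.
Implicit Types (x y t : R).

(** The terms 2 sin (t/2) cos (k t) = sin (k t + t/2) - sin (k t - t/2) telescope. *)
Lemma dirichlet_kernel t n :
  2 * sin (t / 2) * (\sum_(0 <= k < n) cos (k%:R * t)) =
  sin (n%:R * t - t / 2) + sin (t / 2).
Proof.
elim: n => [|n IH].
  by rewrite big_geq // mulr0 mul0r sub0r sinN addNr.
rewrite big_nat_recr //= mulrDr IH.
have -> : n.+1%:R * t - t / 2 = n%:R * t + t / 2 by rewrite -natr1; field.
by rewrite sinB sinD; ring.
Qed.

Lemma cos_2pi_mul (m : nat) x : cos (x + pi * (2 * m)%:R) = cos x.
Proof.
have -> : pi * (2 * m)%:R = pi *+ 2 *+ m :> R by rewrite -mulrnA mulr_natr.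
exact: (periodicn (@cosD2pi R)).
Qed.

Lemma sin_2pi_mul (m : nat) x : sin (x + pi * (2 * m)%:R) = sin x.
Proof.
have -> : pi * (2 * m)%:R = pi *+ 2 *+ m :> R by rewrite -mulrnA mulr_natr.
exact: (periodicn (@sinD2pi R)).
Qed.

Lemma sqr_sin_Dpi (m : nat) x : sin (x + pi * m%:R) ^+ 2 = sin x ^+ 2.
Proof. by rewrite mulr_natr (alternatingn (@sinDpi R)) exprMn sqrr_sign mul1r. Qed.

(* Since d is odd, k * d.+1 / 2 runs over the residues mod d along with k, so
   these are all the frequencies 2 pi k / d; with this numbering sin^2 does not
   see the difference between [frequency d k] and pi k / d, so that 0 is the only
   frequency where it vanishes. *)
Definition frequency (d k : nat) : R := pi * (k * d.+1)%:R / d%:R.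

Lemma frequency0 d : frequency d 0 = 0.
Proof. by rewrite /frequency mul0n mulr0 mul0r. Qed.

Lemma sin_sqr_frequency d k : (0 < d)%N ->
  sin (frequency d k) ^+ 2 = sin (pi * k%:R / d%:R) ^+ 2.
Proof.
move=> d0; rewrite -[RHS](sqr_sin_Dpi k); congr (sin _ ^+ 2).
by rewrite /frequency natrM -natr1; field; rewrite pnatr_eq0 -lt0n.
Qed.

Lemma sin_pi_frac_gt0 (d k : nat) : (0 < k < d)%N -> 0 < sin (pi * k%:R / d%:R) :> R.
Proof.
move=> /andP[k0 kd]; apply: sin_gt0_pi.
have d0 : 0 < d%:R :> R by rewrite ltr0n (leq_trans _ kd).
have k0' : 0 < k%:R :> R by rewrite ltr0n.
rewrite divr_gt0 ?mulr_gt0 ?pi_gt0 //=.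
by rewrite ltr_pdivrMr // ltr_pM2l ?pi_gt0 // ltr_nat.
Qed.

(** Orthogonality of characters mod d. If d does not divide m, the right side of [dirichlet_kernel]
    vanishes, since d t is an even multiple of pi; it remains to see that sin (t/2) is not 0. *)
Lemma dvdn_character_sum (d m : nat) : odd d ->
  (d %| m)%N%:R = d%:R^-1 * \sum_(0 <= k < d) cos (m%:R * frequency d k) :> R.
Proof.
move=> od; have d0 : (0 < d)%N by case: d od.
have dn0 : d%:R != 0 :> R by rewrite pnatr_eq0 -lt0n.
have hE : d.+1 = (2 * uphalf d)%N by rewrite mul2n uphalf_half od; lia.
have [/dvdnP[q ->]|ndm] := boolP (d %| m)%N.
  rewrite (eq_bigr (fun=> 1)) ?sumr_const_nat ?subn0 ?mulVf // => k _.
  have -> : (q * d)%:R * frequency d k = 0 + pi * (2 * (q * k * uphalf d))%:R.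
    have -> : (2 * (q * k * uphalf d) = q * k * d.+1)%N by rewrite hE; lia.
    by rewrite /frequency !natrM; field.
  by rewrite cos_2pi_mul cos0.
pose t : R := pi * (m * d.+1)%:R / d%:R.
rewrite (eq_bigr (fun k => cos (k%:R * t))); last first.
  by move=> k _; congr cos; rewrite /frequency /t !natrM; field.
have := dirichlet_kernel t d.
have -> : d%:R * t - t / 2 = - (t / 2) + pi * (2 * (m * uphalf d))%:R.
  have -> : (2 * (m * uphalf d) = m * d.+1)%N by rewrite hE; lia.
  by rewrite /t; field.
rewrite sin_2pi_mul sinN addNr => /eqP; rewrite !mulf_eq0 -orbA => /or3P[|+|/eqP ->].
- by rewrite pnatr_eq0.
(* [uphalf d] = (d + 1) / 2 is coprime to d, so r is not 0, and t/2 differs from pi r / d by a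
   multiple of pi. *)
- pose r := ((m * uphalf d) %% d)%N.
  have r0 : (0 < r < d)%N.
    rewrite ltn_mod d0 andbT lt0n -/(dvdn d _) Gauss_dvdl //.
    have cop : coprime d d.+1 by exact: coprimenS.
    by move: cop; rewrite hE coprimeMr => /andP[].
  have -> : t / 2 = pi * r%:R / d%:R + pi * ((m * uphalf d) %/ d)%:R.
    have divE : (m * uphalf d)%:R = ((m * uphalf d) %/ d)%:R * d%:R + r%:R :> R.
      by rewrite -natrM -natrD -divn_eq.
    rewrite /t hE mulnCA natrM divE.
    by field.
  rewrite -sqrf_eq0 sqr_sin_Dpi sqrf_eq0.
  by rewrite gt_eqF // sin_pi_frac_gt0.
- by rewrite mulr0.
Qed.

Definition dvd_point (d : nat) (p : int * int) : bool :=
  (d %| `|p.1|)%N && (d %| `|p.2|)%N.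

Lemma cos_absz (z : int) x : cos (z%:~R * x) = cos (`|z|%N%:R * x).
Proof. by case: z => n //=; rewrite NegzE mulrNz mulNr cosN. Qed.

(** Moving the first frequency by pi inserts the parity sign of the first coordinate, so means
    twisted by that sign are again sums of waves. *)
Lemma wave_Dpi x y p : wave (x + pi) y p = (-1) ^+ `|p.1| * wave x y p.
Proof.
rewrite /wave !cos_absz mulrDr [_ * pi]mulrC mulr_natr.
by rewrite (alternatingn (@cosDpi R)) mulrA.
Qed.

Lemma dvd_point_sum d p : odd d -> (dvd_point d p)%:R = d%:R^-2 *
  \sum_(0 <= k < d) \sum_(0 <= l < d) wave (frequency d k) (frequency d l) p :> R.
Proof.
move=> od; rewrite /dvd_point -mulnb natrM !dvdn_character_sum //.
rewrite mulrACA -expr2 exprVn; congr (_ * _).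
rewrite big_distrlr /=; apply: eq_bigr => k _; apply: eq_bigr => l _.
by rewrite /wave !cos_absz.
Qed.

Lemma damping_Dpi x : damping (x + pi) = damping x.
Proof. by rewrite /damping sinDpi sqrrN. Qed.

Lemma sum_damping_le d n : (0 < n)%N ->
  \sum_(1 <= k < d) damping (frequency d k) ^+ n <= 48 * d%:R ^+ 2 / n%:R.
Proof.
move=> n0; apply: (@le_trans _ _ (\sum_(1 <= k < d)
    12 / n%:R * (sin (pi * k%:R / d%:R) ^+ 2)^-1)).
  apply: ler_sum_nat => k /andP[k1 kd].
  have d0 : (0 < d)%N by apply: leq_trans kd.
  have sn0 : sin (frequency d k) != 0.
    by rewrite -sqrf_eq0 sin_sqr_frequency // sqrf_eq0 gt_eqF // sin_pi_frac_gt0 // k1.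
  by have := damping_pow_le n0 sn0; rewrite sin_sqr_frequency.
have c0 : 0 <= 12 / n%:R :> R by rewrite divr_ge0.
rewrite -mulr_sumr; apply: (le_trans (ler_wpM2l c0 (sum_inv_sin2_le R d))).
by rewrite le_eqVlt; apply/orP; left; apply/eqP; field; rewrite pnatr_eq0 -lt0n.
Qed.

(** The factor 4 is that of [word_mean_wave]; with G = 48 d^2 / n, (1 + G)^2 - 1 bounds the damping
    summed over all nonzero pairs of frequencies. The whole is O(1/n) for fixed d, and O(d^-2) as
    long as d^2 = O(n). *)
Definition fourier_error (d n : nat) : R :=
  d%:R^-2 * (4 * ((1 + 48 * d%:R ^+ 2 / n%:R) ^+ 2 - 1)).

(* The main term is the contribution of the frequency (0, 0), moved to (s, 0). *)
Lemma shifted_wave_sum_le s d n : (0 < n)%N -> (0 < d)%N ->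
  (forall x, damping (x + s) = damping x) ->
  `| d%:R^-2 * (\sum_(0 <= k < d) \sum_(0 <= l < d)
       word_mean n (wave (frequency d k + s) (frequency d l)))
     - d%:R^-2 * word_mean n (wave s 0)| <= fourier_error d n.
Proof.
move=> n0 d0 sP.
pose b k := damping (frequency d k) ^+ n.
have b0 k : 0 <= b k by have /andP[? _] := damping_bounds (frequency d k); rewrite exprn_ge0.
have b00 : b 0%N = 1 by rewrite /b frequency0 /damping sin0 expr0n mul0r subr0 expr1n.
pose a k l := word_mean n (wave (frequency d k + s) (frequency d l)).
have ab k l : `|a k l| <= 4 * (b k * b l).
  by rewrite /a /b -(sP (frequency d k)); exact: word_mean_wave.
pose G := \sum_(1 <= k < d) b k.
have G0 : 0 <= G by exact: sumr_ge0.
have GE : \sum_(0 <= k < d) b k = 1 + G by rewrite big_ltn // b00.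
rewrite -mulrBr normrM ger0_norm ?invr_ge0 ?exprn_ge0 // ler_wpM2l ?invr_ge0 ?exprn_ge0 //.
have -> : word_mean n (wave s 0) = a 0%N 0%N by rewrite /a !frequency0 add0r.
rewrite -/a.
have -> : \sum_(0 <= k < d) \sum_(0 <= l < d) a k l - a 0%N 0%N =
   \sum_(1 <= l < d) a 0%N l + \sum_(1 <= k < d) \sum_(0 <= l < d) a k l.
  by rewrite big_ltn // [X in X + _ - _]big_ltn // addrC !addrA addNr add0r.
apply: (@le_trans _ _ (4 * ((1 + G) ^+ 2 - 1))); last first.
  have GX := sum_damping_le d n0; rewrite -/G in GX.
  rewrite ler_pM2l // lerD2r lerXn2r ?nnegrE ?addr_ge0 ?(le_trans _ GX) //.
  by rewrite lerD2l.
apply: (@le_trans _ _ (4 * G + 4 * (G * (1 + G)))); last by lra.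
apply: (le_trans (ler_normD _ _)); apply: lerD.
  rewrite mulr_sumr; apply: (le_trans (ler_norm_sum _ _ _)); apply: ler_sum => l _.
  by have := ab 0%N l; rewrite b00 mul1r.
apply: (le_trans (ler_norm_sum _ _ _)).
rewrite mulr_suml mulr_sumr; apply: ler_sum => k _.
apply: (le_trans (ler_norm_sum _ _ _)).
by rewrite -GE !mulr_sumr; apply: ler_sum => l _; exact: ab.
Qed.

Lemma dvd_point_mean d n : odd d -> (0 < n)%N ->
  `|word_mean n (fun p => (dvd_point d p)%:R) - d%:R^-2| <= fourier_error d n.
Proof.
move=> od n0; have d0 : (0 < d)%N by case: d od.
have := shifted_wave_sum_le n0 d0 (s := 0) (fun x => congr1 _ (addr0 x)).
rewrite [word_mean n (wave 0 0)](eq_word_mean _ (g := fun=> 1)); last first.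
  by move=> p; rewrite /wave !mulr0 cos0 mulr1.
rewrite word_mean1 mulr1; apply: le_trans; rewrite le_eqVlt; apply/orP; left; apply/eqP.
congr (`|_ - _|); rewrite (eq_word_mean _ (fun p => dvd_point_sum p od)) word_meanZ.
rewrite word_mean_sum; congr (_ * _); apply: eq_bigr => k _.
by rewrite word_mean_sum; apply: eq_bigr => l _; rewrite addr0.
Qed.

(** At the shifted main frequency (pi, 0) the eigenvalue T is 0, so that term decays at the rate
    8/12 = 2/3. *)
Lemma dvd_point_twisted_mean d n : odd d -> (0 < n)%N ->
  `|word_mean n (fun p => (-1) ^+ `|p.1| * (dvd_point d p)%:R)| <=
    fourier_error d n + d%:R^-2 * (4 * (2 / 3) ^+ n).
Proof.
move=> od n0; have d0 : (0 < d)%N by case: d od.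
have dV : 0 <= d%:R^-2 :> R by rewrite invr_ge0 exprn_ge0.
have main := shifted_wave_sum_le n0 d0 (s := pi) damping_Dpi.
rewrite (eq_word_mean _ (g := fun p => d%:R^-2 * \sum_(0 <= k < d)
   \sum_(0 <= l < d) wave (frequency d k + pi) (frequency d l) p)); last first.
  move=> p; rewrite dvd_point_sum // mulrCA; congr (_ * _).
  rewrite mulr_sumr; apply: eq_bigr => k _; rewrite mulr_sumr.
  by apply: eq_bigr => l _; rewrite wave_Dpi.
rewrite word_meanZ word_mean_sum.
under eq_bigr do rewrite word_mean_sum.
rewrite -[X in `|X|](subrK (d%:R^-2 * word_mean n (wave pi 0))).
apply: (le_trans (ler_normD _ _)); apply: lerD => //.
rewrite normrM (ger0_norm dV) ler_wpM2l // /word_mean.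
have T0 : 2 * cos pi + 2 * cos 0 = 0 :> R by rewrite cospi cos0; ring.
have [|W1 W2 WS] := word_sum_eigen (wave_eigen pi (0 : R)).
  by rewrite /wave /= !mul0r cos0 mulr1.
rewrite T0 in W1 W2 WS.
have T4 : `|0 : R| <= 4 by rewrite normr0.
have := recurrence_bound (S := fun n => word_sum letter_vector n (wave pi 0)) T4 W1 W2 WS n.
have p3 : 0 < 4 * 3 ^+ n :> R by rewrite mulr_gt0 ?exprn_gt0.
rewrite normr0 addr0 normrM normfV (gtr0_norm p3) ler_pdivrMr // => /le_trans; apply.
have -> : 8 / 12 = 2 / 3 :> R by field.
by rewrite le_eqVlt; apply/orP; left; apply/eqP; ring.
Qed.

End Characters.

(** * The values of zeta(2) and of the Euler product *)

Section BaselEuler.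
Variable R : realType.

Lemma inv_sin2_bounds (t : R) : 0 < t < pi / 2 ->
  (t ^+ 2)^-1 <= (sin t ^+ 2)^-1 <= (t ^+ 2)^-1 + 1.
Proof.
move=> /andP[t0 tpi]; have pi0 := pi_gt0 R.
have s0 : 0 < sin t by apply: sin_gt0_pi; rewrite t0 /=; lra.
have c0 : 0 < cos t by apply: cos_gt0_pihalf; rewrite tpi andbT; lra.
have /sin_mvt/andP[tc st] : 0 <= t <= pi by rewrite ltW //=; lra.
apply/andP; split.
  by rewrite lef_pV2 ?posrE ?exprn_gt0 // lerXn2r // nnegrE ltW.
rewrite -lerBlDr.
have -> : (sin t ^+ 2)^-1 - 1 = (cos t / sin t) ^+ 2.
  rewrite expr_div_n -[1](divff (_ : sin t ^+ 2 != 0)) ?expf_neq0 ?gt_eqF //.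
  by rewrite -[X in X - _]mul1r -mulrBl cos2sin2.
rewrite -exprVn lerXn2r ?nnegrE ?divr_ge0 ?invr_ge0 ?(ltW t0) ?(ltW c0) ?(ltW s0) //.
by rewrite ler_pdivrMr // mulrC ler_pdivlMr // mulrC.
Qed.

Lemma inv_sin2_half (x : R) : sin x != 0 ->
  (sin (x / 2) ^+ 2)^-1 + (sin (pi / 2 - x / 2) ^+ 2)^-1 = 4 * (sin x ^+ 2)^-1.
Proof.
have -> : sin (pi / 2 - x / 2) = cos (x / 2).
  by rewrite sinB sin_pihalf cos_pihalf mul1r mul0r subr0.
have -> : sin x = 2 * (cos (x / 2) * sin (x / 2)).
  by rewrite mulr_natl -sin_mulr2n; congr sin; rewrite mulr2n; field.
rewrite !mulf_eq0 !negb_or => /and3P[_ c0 s0].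
have -> : 4 * ((2 * (cos (x / 2) * sin (x / 2))) ^+ 2)^-1 =
  (cos (x / 2) ^+ 2 + sin (x / 2) ^+ 2) / (cos (x / 2) * sin (x / 2)) ^+ 2.
  by rewrite cos2Dsin2; field; rewrite c0 s0.
by field; rewrite c0 s0.
Qed.

Definition odd_angle (N k : nat) : R := pi * k.*2.+1%:R / (4 * N%:R).

Lemma odd_angle_bounds N k : (k < N)%N -> 0 < odd_angle N k < pi / 2.
Proof.
move=> kN; have N0 : 0 < N%:R :> R by rewrite ltr0n (leq_trans _ kN).
rewrite /odd_angle divr_gt0 ?mulr_gt0 ?pi_gt0 //= ltr_pdivrMr ?mulr_gt0 //.
have -> : pi / 2 * (4 * N%:R) = pi * (2 * N)%:R :> R by rewrite natrM; field.
by rewrite ltr_pM2l ?pi_gt0 // ltr_nat; lia.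
Qed.

(** Half of [odd_angle N k] and the complement of that half are the angles of index k and 2N - 1 - k
    among the next 2N, so by [inv_sin2_half] each halving multiplies the sum by 4. It starts with
    the value 2 at pi/4. *)
Lemma sum_inv_sin2_odd_angle n :
  \sum_(0 <= k < 2 ^ n) (sin (odd_angle (2 ^ n) k) ^+ 2)^-1 = 2 * 4 ^+ n.
Proof.
elim: n => [|n IH].
  rewrite big_nat1; have -> : odd_angle (2 ^ 0) 0 = pi / 2 / 2
      by rewrite /odd_angle expn0 double0; field.
  rewrite expr0 mulr1.
  have := @inv_sin2_half (pi / 2); rewrite sin_pihalf oner_eq0 => /(_ isT).
  have -> : pi / 2 - pi / 2 / 2 = pi / 2 / 2 :> R by field.
  by rewrite expr1n invr1; lra.
rewrite exprS mulrCA -IH expnS mul2n -addnn.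
rewrite (@big_cat_nat _ _ _ (2 ^ n)) ?leq_addr //=.
rewrite [X in _ + X](_ : _ = \sum_(0 <= k < 2 ^ n)
   (sin (odd_angle (2 ^ n + 2 ^ n) (2 ^ n + 2 ^ n - k.+1)) ^+ 2)^-1); last first.
  rewrite -{1}[(2 ^ n)%N]add0n big_addn addnK big_nat_rev /= add0n.
  by apply: eq_big_nat => k /andP[_ kN]; congr ((sin (odd_angle _ _) ^+ 2)^-1); lia.
rewrite -big_split /= mulr_sumr; apply: eq_big_nat => k /andP[_ kN].
have /andP[x0 xpi] := odd_angle_bounds kN.
rewrite -inv_sin2_half; last first.
  by rewrite gt_eqF // sin_gt0_pi // x0 /=; have := pi_gt0 R; lra.
have N0 : (2 ^ n)%:R != 0 :> R by rewrite pnatr_eq0 expn_eq0.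
have N2 : (2 ^ n)%:R + (2 ^ n)%:R != 0 :> R.
  by rewrite -natrD pnatr_eq0 addn_eq0 expn_eq0.
congr ((sin _ ^+ 2)^-1 + (sin _ ^+ 2)^-1); rewrite /odd_angle natrD.
  by field; rewrite N0 N2.
have -> : ((2 ^ n + 2 ^ n - k.+1).*2.+1 = 4 * 2 ^ n - k.*2.+1)%N by lia.
by rewrite natrB ?natrM; [field; rewrite N0 N2|lia].
Qed.

(** The index 0 contributes 0, by the convention for the inverse of 0. *)
Definition sqsum (P : pred nat) (N : nat) : R :=
  \sum_(0 <= k < N | P k) (k%:R ^+ 2)^-1.

Lemma nondecreasing_sqsum P : nondecreasing_seq (sqsum P).
Proof.
move=> m n mn; rewrite /sqsum (big_cat_nat _ mn) //= lerDl.
by apply: sumr_ge0 => k _; rewrite invr_ge0 sqr_ge0.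
Qed.

Lemma sqsum_odd N : sqsum odd N.*2 = \sum_(0 <= k < N) (k.*2.+1%:R ^+ 2)^-1.
Proof.
rewrite /sqsum; elim: N => [|N IH]; first by rewrite !big_geq.
rewrite doubleS big_mkcond !big_nat_recr //= -big_mkcond /= IH.
by rewrite odd_double /= addr0.
Qed.

(** Summed over the 2^n angles t, [inv_sin2_bounds] puts the sum of t^-2 within 2^n of 2 * 4^n;
    scaling by pi^2 / (16 * 4^n) gives both bounds. *)
Lemma sqsum_odd_bounds n :
  sqsum odd (2 ^ n).*2 <= pi ^+ 2 / 8 <= sqsum odd (2 ^ n).*2 + pi ^+ 2 / (16 * 2 ^+ n).
Proof.
have N0 : 0 < 2 ^+ n :> R by rewrite exprn_gt0.
have pi0 := pi_gt0 R.
have E : \sum_(0 <= k < 2 ^ n) (odd_angle (2 ^ n) k ^+ 2)^-1 =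
    16 * (2 ^+ n) ^+ 2 / pi ^+ 2 * sqsum odd (2 ^ n).*2.
  rewrite sqsum_odd mulr_sumr; apply: eq_bigr => k _.
  rewrite /odd_angle natrX; have : 0 < k.*2.+1%:R :> R by [].
  move: (k.*2.+1%:R) (pi) pi0 => u q q0 u0.
  by field; rewrite !gt_eqF.
have lb : \sum_(0 <= k < 2 ^ n) (odd_angle (2 ^ n) k ^+ 2)^-1 <= 2 * 4 ^+ n.
  rewrite -sum_inv_sin2_odd_angle; apply: ler_sum_nat => k /andP[_ kN].
  by have /andP[] := inv_sin2_bounds (odd_angle_bounds kN).
have ub : 2 * 4 ^+ n <= \sum_(0 <= k < 2 ^ n) (odd_angle (2 ^ n) k ^+ 2)^-1 + 2 ^+ n.
  rewrite -sum_inv_sin2_odd_angle.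
  have -> : 2 ^+ n = \sum_(0 <= k < 2 ^ n) 1 :> R by rewrite sumr_const_nat subn0 natrX.
  rewrite -big_split /=; apply: ler_sum_nat => k /andP[_ kN].
  by have /andP[] := inv_sin2_bounds (odd_angle_bounds kN).
have F : 4 ^+ n = (2 ^+ n) ^+ 2 :> R.
  by rewrite -exprM mulnC exprM; congr (_ ^+ _); ring.
move: lb ub; rewrite E F; move: (2 ^+ n) (pi) (sqsum _ _) N0 pi0 => K q A K0 q0 lb ub.
have c0 : 0 <= q ^+ 2 / (16 * K ^+ 2)
    by apply: divr_ge0; [exact: sqr_ge0|apply: mulr_ge0 => //; exact: sqr_ge0].
have := ler_wpM2r c0 lb; have := ler_wpM2r c0 ub.
have -> : 2 * K ^+ 2 * (q ^+ 2 / (16 * K ^+ 2)) = q ^+ 2 / 8 by field; rewrite gt_eqF.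
have -> : (16 * K ^+ 2 / q ^+ 2 * A + K) * (q ^+ 2 / (16 * K ^+ 2)) = A + q ^+ 2 / (16 * K).
  by field; rewrite !gt_eqF.
have -> : 16 * K ^+ 2 / q ^+ 2 * A * (q ^+ 2 / (16 * K ^+ 2)) = A.
  by field; rewrite !gt_eqF.
by move=> -> ->.
Qed.


Lemma cvg_sqsum_odd : sqsum odd @ \oo --> pi ^+ 2 / 8.
Proof.
have ub N : sqsum odd N <= pi ^+ 2 / 8.
  have /andP[+ _] := sqsum_odd_bounds N; apply: le_trans.
  by apply: nondecreasing_sqsum; have := ltn_expl N (isT : 1 < 2)%N; lia.
apply/cvgrPdist_le => e e0.
have c0 : 0 <= pi ^+ 2 / e by rewrite divr_ge0 ?sqr_ge0 // ltW.
have [n hn] : exists n, pi ^+ 2 / (16 * 2 ^+ n) <= e.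
  exists (Num.bound (pi ^+ 2 / e)).
  have bn := archi_boundP c0.
  have bn2 : (Num.bound (pi ^+ 2 / e))%:R <= 2 ^+ Num.bound (pi ^+ 2 / e) :> R.
    by rewrite -natrX ler_nat ltnW // ltn_expl.
  have p0 : 0 < 2 ^+ Num.bound (pi ^+ 2 / e) :> R by rewrite exprn_gt0.
  rewrite ler_pdivrMr ?mulr_gt0 // mulrC -ler_pdivrMr //.
  by apply: (le_trans (ltW bn)); apply: (le_trans bn2); lra.
exists (2 ^ n).*2 => // m /= nm.
have /andP[_ h] := sqsum_odd_bounds n.
have := nondecreasing_sqsum odd nm; have := ub m.
by rewrite ler_norml => h1 h2; apply/andP; split; lra.
Qed.

(** Substitute k = p j; (N + p - 1) / p is the ceiling of N / p, the number of multiples of p below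
    N. *)
Lemma sqsum_multiples (p : nat) (P : pred nat) N : (0 < p)%N ->
  sqsum (fun k => (p %| k)%N && P (k %/ p)%N) N =
    p%:R^-2 * sqsum P ((N + p.-1) %/ p).
Proof.
move=> p0; elim: N => [|N IH].
  rewrite /sqsum add0n divn_small ?prednK //.
  by rewrite !big_geq // mulr0.
rewrite {1}/sqsum big_mkcond big_nat_recr //= -big_mkcond -/(sqsum _ N) IH.
have [/dvdnP[q ->]|ndv] := boolP (p %| N)%N.
  have -> : (((q * p).+1 + p.-1) %/ p = q.+1)%N.
    by rewrite addSnnS prednK // divnMDl // divnn p0 /= addn1.
  rewrite divnMDl // divn_small ?prednK // addn0 mulnK //.
  rewrite /sqsum [in RHS]big_mkcond big_nat_recr //= -big_mkcond mulrDr.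
  by congr (_ + _); case: (P q); rewrite ?mulr0 // natrM exprMn invfM mulrC.
rewrite /= addr0; congr (_ * sqsum _ _).
have := divn_eq N p; have : (0 < N %% p)%N by rewrite lt0n.
have := ltn_pmod N p0; move: (N %/ p)%N (N %% p)%N => q r rp r0 ->.
have E j : (0 < j <= p)%N -> ((q * p + j + p.-1) %/ p = q.+1)%N.
  move=> /andP[j0 jp].
  have -> : (q * p + j + p.-1 = q.+1 * p + j.-1)%N by rewrite mulSn; lia.
  by rewrite divnMDl // divn_small ?addn0 //; lia.
by rewrite -addnS !E // ?r0 //= ltnW.
Qed.

(** By the hypothesis on [P], its multiples of p are p times its members, so they carry the fraction
    p^-2 of the sum. *)
Lemma cvg_sqsum_sieve (p : nat) (P : pred nat) (L : R) : (0 < p)%N ->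
  (forall k, (p %| k)%N -> P k = P (k %/ p)%N) ->
  sqsum P @ \oo --> L ->
  sqsum (fun k => P k && ~~ (p %| k)%N) @ \oo --> (1 - p%:R^-2) * L.
Proof.
move=> p0 Pp PL.
have -> : sqsum (fun k => P k && ~~ (p %| k)%N) =
    (fun N => sqsum P N - p%:R^-2 * sqsum P ((N + p.-1) %/ p)).
  apply/funext => N; rewrite -sqsum_multiples // /sqsum.
  rewrite [X in X - _](bigID (dvdn p)) /= addrAC.
  rewrite [X in X - _ + _](eq_bigl (fun k => (p %| k)%N && P (k %/ p)%N)) ?subrr ?add0r //.
  by move=> k /=; case: (boolP (p %| k)%N) => [/Pp ->|]; rewrite ?andbT ?andbF.
rewrite mulrBl mul1r; apply: cvgB => //; apply: cvgMr.
apply: (cvg_comp _ _ _ PL).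
have h : (divn^~ p \o addn^~ p.-1) @ \oo --> \oo.
  by apply: (@cvg_comp _ _ _ _ _ _ \oo); [exact: cvg_addnr|exact: cvg_divnr].
exact: h.
Qed.

Lemma zeta2E : zeta (2 : R) = pi ^+ 2 / 6.
Proof.
have cz : cvgn (sqsum predT).
  apply: nondecreasing_is_cvgn; first exact: nondecreasing_sqsum.
  exists 2 => _ [N _ <-]; rewrite /sqsum.
  have [N2|N2] := leqP N 2.
    apply: le_trans (nondecreasing_sqsum predT N2) _.
    by rewrite /sqsum big_nat_recr //= big_nat1 expr0n invr0 expr1n invr1; lra.
  rewrite big_ltn 1?(ltn_trans _ N2) // big_ltn 1?(ltn_trans _ N2) //.
  have := @sum_inv_sqr_le R 1 N isT.
  by rewrite expr0n invr0 expr1n invr1; lra.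
have h : sqsum odd @ \oo --> (1 - 2%:R^-2) * limn (sqsum predT).
  have := @cvg_sqsum_sieve 2 predT _ isT (fun _ _ => erefl) cz.
  apply: cvg_trans; apply: near_eq_cvg; near=> N.
  by apply: eq_bigl => k; rewrite /= dvdn2 negbK.
have := cvg_unique _ h cvg_sqsum_odd.
have -> : zeta 2 = limn (sqsum predT).
  apply: cvg_lim => //.
  have -> : series (fun n => n.+1%:R `^ (- 2)) = (fun N => sqsum predT N.+1) :> (R ^nat).
    apply/funext => N; rewrite /series /sqsum /= [RHS]big_nat_recl //.
    rewrite expr0n invr0 add0r; apply: eq_bigr => k _.
    by rewrite powRN -(powR_mulrn 2).
  by rewrite cvg_shiftS; exact: cz.
move=> e; have : 4 / 3 * ((1 - 2%:R^-2) * limn (sqsum predT)) = 4 / 3 * (pi ^+ 2 / 8).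
  by rewrite e.
move: (limn _) (pi ^+ 2) => z q; lra.
Unshelve. all: by end_near. Qed.

(** * The Euler product over odd primes *)

Definition odd_prime : pred nat := fun p => prime p && odd p.

Definition free_of (l : seq nat) (k : nat) : bool := all (fun p => ~~ (p %| k)%N) l.

Definition euler_product (l : seq nat) : R := \prod_(p <- l) (1 - p%:R^-2).

Lemma cvg_sqsum_free_of l : uniq l -> all odd_prime l ->
  sqsum (fun k => odd k && free_of l k) @ \oo --> euler_product l * (pi ^+ 2 / 8).
Proof.
rewrite /euler_product; elim: l => [_ _|p l IH /= /andP[pl ul] /andP[/andP[pp op] al]].
  rewrite big_nil mul1r.
  rewrite (_ : (fun k => _) = odd) //; first exact: cvg_sqsum_odd.
  by apply/funext => k; rewrite andbT.
rewrite big_cons -mulrA.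
have -> : (fun k => odd k && (~~ (p %| k)%N && free_of l k)) =
    (fun k => (odd k && free_of l k) && ~~ (p %| k)%N).
  by apply/funext => k; rewrite -andbA [X in _ && X]andbC.
apply: cvg_sqsum_sieve; [exact: prime_gt0| |exact: IH].
move=> k /dvdnP[q ->]; rewrite mulnK ?prime_gt0 // oddM op andbT; congr (_ && _).
apply: eq_in_all => r rl; have /andP[rp _] := allP al r rl.
rewrite Euclid_dvdM //; case: (boolP (r %| p)%N) => [|_]; last by rewrite orbF.
by rewrite dvdn_prime2 // => /eqP rE; move: pl; rewrite -rE rl.
Qed.

Definition odd_primes (Q : nat) : seq nat := [seq p <- iota 0 Q.+1 | odd_prime p].

Lemma mem_odd_primes Q p : (p \in odd_primes Q) = odd_prime p && (p <= Q)%N.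
Proof. by rewrite mem_filter mem_iota add0n ltnS. Qed.

(** The product times pi^2 / 8 is the sum of k^-2 over odd k free of odd primes up to Q: k = 1
    contributes 1, and any other such k exceeds Q, because its least prime factor does. *)
Lemma euler_product_bounds Q : (0 < Q)%N ->
  1 <= euler_product (odd_primes Q) * (pi ^+ 2 / 8) <= 1 + Q%:R^-1.
Proof.
move=> Q0; have := @cvg_sqsum_free_of (odd_primes Q) (filter_uniq _ (iota_uniq _ _)).
move=> /(_ (filter_all _ _)) cv; apply/andP; split.
  apply: (cvgr_to_ge cv); exists 2 => // N /= N2.
  rewrite /sqsum big_mkcond big_ltn ?(ltn_trans _ N2) // big_ltn //=.
  rewrite expr1n invr1 add0r ifT;
      first by rewrite lerDl sumr_ge0 // => k _; case: ifP => // _; rewrite invr_ge0 sqr_ge0.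
  by apply/allP => p; rewrite mem_odd_primes => /andP[/andP[pp _] _];
      rewrite dvdn1; case: eqP pp => // ->.
apply: (cvgr_to_le cv); exists Q.+1 => // N /= QN.
rewrite /sqsum (big_cat_nat _ QN) //=; apply: lerD; last first.
  apply: le_trans (sum_inv_sqr_le R N Q0).
  rewrite [leLHS]big_mkcond; apply: ler_sum => k _; case: ifP => // _.
rewrite big_mkcond (big_ltn (ltn0Sn _)) big_ltn //= add0r expr1n invr1.
rewrite big_nat big1 => [|k /andP[k1 kQ]]; first by case: ifP; lra.
rewrite ifF //; apply/negbTE/negP => /andP[ok /allP].
move=> /(_ (pdiv k)); rewrite pdiv_dvd mem_odd_primes /odd_prime pdiv_prime //=.
rewrite (leq_trans (pdiv_leq _)) ?andbT //; last by lia.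
by rewrite (dvdn_odd (pdiv_dvd k) ok) => /(_ isT).
Qed.

End BaselEuler.

(** * The sieve *)

Section Sieve.
Variable R : realType.
Implicit Types (w : pred (int * int)) (c : R).

Definition word_freq n (P : pred (int * int)) : R := word_mean n (fun p => (P p)%:R).

Lemma word_freq_le n (P Q : pred (int * int)) :
  (forall p, P p -> Q p) -> word_freq n P <= word_freq n Q.
Proof.
move=> PQ; apply: word_mean_le => p; rewrite ler_nat.
by case: (P p) (PQ p) => //= ->.
Qed.

Lemma eq_word_freq n (P Q : pred (int * int)) : P =1 Q -> word_freq n P = word_freq n Q.
Proof. by move=> PQ; apply: eq_word_mean => p; rewrite PQ. Qed.

Lemma cvg_harmonicZ (x : R) : (fun n => x / n%:R) @ \oo --> 0.
Proof.
rewrite -[X in _ --> X](mulr0 x); apply: cvgMr.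
by rewrite -cvg_shiftS; exact: cvg_harmonic.
Qed.

Lemma cvg_fourier_error d : (fun n => fourier_error R d n) @ \oo --> 0.
Proof.
have h := cvg_harmonicZ (48 * d%:R ^+ 2).
rewrite [X in _ --> X](_ : _ = d%:R^-2 * (4 * ((1 + 0) * (1 + 0) - 1))); last by ring.
apply: cvgMr; apply: cvgMr; apply: cvgB; last exact: cvg_cst.
by apply: cvgM; apply: cvgD => //; exact: cvg_cst.
Qed.

Lemma cvg_bounded_dist (u e : R ^nat) (l : R) :
  (forall n, (0 < n)%N -> `|u n - l| <= e n) -> e @ \oo --> 0 -> u @ \oo --> l.
Proof.
move=> ue e0; apply/cvgrPdist_le => eps eps0.
move/cvgrPdist_le : e0 => /(_ _ eps0) e0; near=> n.
rewrite distrC (le_trans (ue n _)) //; first by near: n; exists 1%N.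
by rewrite (le_trans (ler_norm _)) // -normrN -sub0r; near: n.
Unshelve. all: by end_near. Qed.

Lemma cvg_freq_dvd d : odd d -> word_freq ^~ (dvd_point d) @ \oo --> (d%:R^-2 : R).
Proof.
move=> od; apply: cvg_bounded_dist (cvg_fourier_error d) => n n0.
exact: dvd_point_mean.
Qed.

(** The indicator of odd x is (1 - (-1)^x) / 2, and the twisted mean tends to 0. *)
Lemma cvg_freq_odd_dvd d : odd d ->
  (fun n => word_freq n (fun p => odd `|p.1| && dvd_point d p)) @ \oo --> (2^-1 * d%:R^-2 : R).
Proof.
move=> od.
have tw : (fun n => word_mean n (fun p => (-1) ^+ `|p.1| * (dvd_point d p)%:R : R))
    @ \oo --> (0 : R).
  apply: (@cvg_bounded_dist _ (fun n => fourier_error R d n + d%:R^-2 * (4 * (2 / 3) ^+ n))).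
    by move=> n n0; rewrite subr0; exact: dvd_point_twisted_mean.
  rewrite -[X in _ --> X](addr0 (0 : R)); apply: cvgD; first exact: cvg_fourier_error.
  rewrite [X in _ --> X](_ : _ = d%:R^-2 * (4 * 0) :> R); last by ring.
  apply: cvgMr; apply: cvgMr; apply: cvg_expr.
  by rewrite ger0_norm; lra.
have -> : (fun n => word_freq n (fun p => odd `|p.1| && dvd_point d p)) = (fun n =>
    2^-1 * (word_freq n (dvd_point d) -
        word_mean n (fun p => (-1) ^+ `|p.1| * (dvd_point d p)%:R))).
  apply/funext => n; rewrite -word_meanB -word_meanZ; apply: eq_word_mean => p.
  by rewrite -signr_odd; case: odd; case: dvd_point; rewrite /= ?expr0 ?expr1; field.
apply: cvgMr; rewrite -[X in _ --> X]subr0; apply: cvgB => //.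
exact: cvg_freq_dvd.
Qed.

Definition avoid (l : seq nat) (p : int * int) : bool := all (fun q => ~~ dvd_point q p) l.

Definition odd_primitive (p : int * int) : bool :=
  `[< forall q, odd_prime q -> ~~ dvd_point q p >].

Lemma dvd_pointM q d p : coprime q d -> dvd_point (q * d) p = dvd_point q p && dvd_point d p.
Proof. by move=> qd; rewrite /dvd_point !Gauss_dvd // andbACA. Qed.

Section Weighted.
(** The sieve runs once with [w] the oddness of the first coordinate and c = 1/2, and once with [w]
    constantly true and c = 1. *)
Variables (w : pred (int * int)) (c : R).
Hypothesis c01 : 0 <= c <= 1.
Hypothesis freq_dvd : forall d, odd d ->
  (fun n => word_freq n (fun p => w p && dvd_point d p)) @ \oo --> c * d%:R^-2.

(** Primes are removed one at a time, by subtracting the points they divide. The divisor d is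
    carried along because the subtracted term has q d in place of d. *)
Lemma cvg_freq_avoid l d : uniq l -> all odd_prime l -> odd d -> all (coprime d) l ->
  (fun n => word_freq n (fun p => w p && avoid l p && dvd_point d p)) @ \oo -->
    c * euler_product R l * d%:R^-2.
Proof.
elim: l d => [|q l IH] d.
  move=> _ _ od _; rewrite /euler_product big_nil mulr1.
  by under eq_fun do under eq_word_freq do rewrite andbT; exact: freq_dvd.
move=> /= /andP[ql ul] /andP[/andP[pq oq] al] od /andP[dq dl].
have qd : coprime q d by rewrite coprime_sym.
have -> : (fun n => word_freq n (fun p => w p && avoid (q :: l) p && dvd_point d p))
    = (fun n =>
    word_freq n (fun p => w p && avoid l p && dvd_point d p) -
    word_freq n (fun p => w p && avoid l p && dvd_point (q * d) p)).
  apply/funext => n; rewrite -word_meanB; apply: eq_word_mean => p.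
  rewrite dvd_pointM //= .
  by case: (w p) (avoid l p) (dvd_point q p) (dvd_point d p) => [] [] [] [];
      rewrite /= ?subrr ?subr0.
have -> : c * euler_product R (q :: l) * d%:R^-2 =
    c * euler_product R l * d%:R^-2 - c * euler_product R l * (q * d)%:R^-2.
  have q0 : q%:R != 0 :> R by rewrite pnatr_eq0 -lt0n prime_gt0.
  have d0 : d%:R != 0 :> R by rewrite pnatr_eq0; apply: contraTneq od => ->.
  by rewrite /euler_product big_cons natrM; field; rewrite q0 d0.
apply: cvgB; first exact: IH.
apply: IH; rewrite ?oddM ?oq //.
apply/allP => r rl; rewrite coprimeMl (allP dl r rl) andbT.
have /andP[pr _] := allP al r rl.
rewrite prime_coprime // dvdn_prime2 //.
by apply: contraNneq ql => ->.
Qed.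

Lemma sqr_dvd_point_le d p : p != 0 -> dvd_point d p -> d%:R ^+ 2 <= sqnorm R p.
Proof.
case: p => x y; rewrite /dvd_point /sqnorm /= => p0 /andP[dx dy].
have key (z : int) : (d %| `|z|)%N -> z != 0 -> d%:R ^+ 2 <= z%:~R ^+ 2 :> R.
  move=> dz z0; rewrite -[z%:~R ^+ 2]real_normK ?num_real //.
  rewrite lerXn2r ?nnegrE // -intr_norm -abszE -pmulrn ler_nat.
  by rewrite dvdn_leq // absz_gt0.
have [x0|x0] := eqVneq x 0; last by rewrite (le_trans (key x dx x0)) // lerDl sqr_ge0.
have [y0|y0] := eqVneq y 0; last by rewrite (le_trans (key y dy y0)) // lerDr sqr_ge0.
by move: p0; rewrite x0 y0 eqxx.
Qed.

(* A point that survives the sieve by the primes up to Q but is divisible by a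
   further prime q is either far from the origin, or q is O(sqrt n) and the
   Fourier error at q is comparable to the main term q^-2. *)
Lemma sieve_tail Q M n : (2 < Q)%N -> (0 < M)%N -> (0 < n)%N ->
  word_freq n (fun p => w p && avoid (odd_primes Q) p)
    - word_freq n (fun p => w p && odd_primitive p)
  <= 4 / M%:R + 4 * (1 + 48 * M%:R) ^+ 2 / Q%:R.
Proof.
move=> Q2 M0 n0.
have M0' : 0 < M%:R :> R by rewrite ltr0n.
have n0' : 0 < n%:R :> R by rewrite ltr0n.
pose small d := odd d && (d ^ 2 <= M * n)%N.
(* Far points are charged to |p|^2 / (M n), as in Markov's inequality; near ones to an odd d > Q,
   prime or not, with d^2 <= M n. *)
apply: (@le_trans _ _ (word_mean n (fun p => (M * n)%:R^-1 * sqnorm R p +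
   \sum_(Q.+1 <= d < (M * n).+1 | small d) (dvd_point d p)%:R))).
  rewrite -word_meanB; apply: word_mean_le => p.
  have sum0 : 0 <= \sum_(Q.+1 <= d < (M * n).+1 | small d) (dvd_point d p)%:R :> R.
    by apply: sumr_ge0.
  have sq0 : 0 <= (M * n)%:R^-1 * sqnorm R p.
    by rewrite mulr_ge0 ?invr_ge0 // addr_ge0 ?sqr_ge0.
  case: (w p) => /=; last by rewrite subrr addr_ge0.
  case: (boolP (avoid _ p)) => [av|_]; last first.
    by rewrite (le_trans _ (addr_ge0 sq0 sum0)) // sub0r oppr_le0.
  case: (boolP (odd_primitive p)) => [_|]; first by rewrite subrr addr_ge0.
  move=> /asboolPn /existsNP[q /not_implyP[oq /negP]]; rewrite negbK subr0 => qp.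
  have Qq : (Q < q)%N.
    rewrite ltnNge; apply/negP => qQ; move/allP: av => /(_ q).
    by rewrite mem_odd_primes oq qQ qp => /(_ isT).
  have p0 : p != 0.
    (* The origin does not survive the sieve: 3 is among the sieving primes because Q > 2. *)
    apply: contraTneq av => ->; apply/allPn; exists 3; first by rewrite mem_odd_primes.
    by rewrite negbK.
  have [big|small_p] := leP (M * n)%:R (sqnorm R p).
    rewrite -[leLHS]addr0 lerD // mulrC ler_pdivlMr ?mul1r //.
    by rewrite ltr0n muln_gt0 M0.
  have q2 : (q ^ 2 <= M * n)%N.
    by rewrite -(ler_nat R) natrX (le_trans (sqr_dvd_point_le p0 qp)) // ltW.
  rewrite -[leLHS]add0r lerD // big_mkcond (bigD1_seq q) /= ?iota_uniq //.
    have /andP[_ oq'] := oq.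
    by rewrite /small oq' q2 qp lerDl sumr_ge0 // => i _; case: ifP.
  rewrite mem_index_iota Qq ltnS (leq_trans _ q2) // -mulnn leq_pmulr //.
  by rewrite (leq_ltn_trans _ Qq).
rewrite word_meanD word_meanZ; apply: lerD.
  apply: (@le_trans _ _ ((M * n)%:R^-1 * (2 * n.+1%:R))).
    by rewrite ler_wpM2l ?invr_ge0 //; exact: word_mean_sqnorm.
  rewrite natrM mulrC ler_pdivrMr ?mulr_gt0 //.
  have -> : 4 / M%:R * (M%:R * n%:R) = 4 * n%:R :> R by field; rewrite gt_eqF.
  by rewrite -[n.+1]addn1 natrD; move: (ler1n R n); rewrite n0; lra.
rewrite (eq_word_mean _ (g := fun p => \sum_(d <-
    [seq d <- index_iota Q.+1 (M * n).+1 | small d])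
   (dvd_point d p)%:R)); last by move=> p; rewrite big_filter.
rewrite word_mean_sum big_filter.
apply: (@le_trans _ _ (\sum_(Q.+1 <= d < (M * n).+1 | small d)
    4 * (1 + 48 * M%:R) ^+ 2 * (d%:R ^+ 2)^-1)).
  apply: ler_sum => d /andP[od d2].
  have := dvd_point_mean R od n0; rewrite ler_norml => /andP[_].
  rewrite /fourier_error => h.
  have d2' : d%:R ^+ 2 / n%:R <= M%:R :> R.
    by rewrite ler_pdivrMr // -natrX -natrM ler_nat.
  have dV : 0 <= d%:R ^- 2 :> R by rewrite invr_ge0 sqr_ge0.
  have s0 : 0 <= d%:R ^+ 2 / n%:R :> R by rewrite divr_ge0 ?sqr_ge0.
  have sq : (1 + 48 * d%:R ^+ 2 / n%:R) ^+ 2 <= (1 + 48 * M%:R) ^+ 2 :> R.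
    by rewrite lerXn2r ?nnegrE //; lra.
  have sq' := ler_wpM2l dV sq.
  by move: h; rewrite -mulrA; lra.
rewrite -mulr_sumr ler_wpM2l ?mulr_ge0 ?sqr_ge0 //.
apply: le_trans (sum_inv_sqr_le R (M * n).+1 (ltn_trans _ Q2)) => //.
by rewrite [leLHS]big_mkcond; apply: ler_sum => d _; case: ifP.
Qed.

(** [sieve_tail] is uniform in n, so the limit in n at fixed Q and the limit in Q can be
    exchanged. *)
Lemma cvg_freq_odd_primitive :
  (fun n => word_freq n (fun p => w p && odd_primitive p)) @ \oo --> c * (8 / pi ^+ 2).
Proof.
apply/cvgrPdist_le => e e0.
have pi2 : 4 <= pi ^+ 2 :> R by have := pi_ge2 R; rewrite expr2; nra.
have e4 : 0 < e / 4 by lra.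
have pick (x : R) : 0 <= x -> exists2 N, (2 < N)%N & forall m, (N <= m)%N -> x / m%:R <= e / 4.
  move=> x0; have [N b] : exists N : nat, x / (e / 4) < N%:R.
    by eexists; apply: archi_boundP; rewrite divr_ge0 // ltW.
  exists N.+3 => // m Nm.
  have m0 : 0 < m%:R :> R by rewrite ltr0n (leq_trans _ Nm).
  rewrite ler_pdivrMr // mulrC -ler_pdivrMr // (le_trans (ltW b)) // ler_nat.
  by apply: leq_trans Nm; lia.
(* M is chosen first, then Q in terms of M. The four quarters of e pay for the two tail terms, the
   Euler product and the limit in n. *)
have [M M2 /(_ M (leqnn M)) hM] := pick 4 ltac:(lra).
have [Q1 _ hQ1] := pick (4 * (1 + 48 * M%:R) ^+ 2) ltac:(rewrite mulr_ge0 // sqr_ge0).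
have [Q2 Q22 hQ2] := pick 2 ltac:(lra).
pose Q := maxn Q1 Q2.
have Q3 : (2 < Q)%N by rewrite (leq_trans Q22) // leq_maxr.
have {}hQ1 := hQ1 Q (leq_maxl _ _); have {}hQ2 := hQ2 Q (leq_maxr _ _).
have M0 : (0 < M)%N by apply: ltn_trans M2.
have := cvg_freq_avoid (l := odd_primes Q) (d := 1) (filter_uniq _ (iota_uniq _ _))
  (filter_all _ _) isT ltac:(apply/allP => q _; exact: coprime1n).
move=> /cvgrPdist_le/(_ _ e4) cv.
have /andP[lb ub] := @euler_product_bounds R Q (ltn_trans (isT : 0 < 2)%N Q3).
have Elb : 8 / pi ^+ 2 <= euler_product R (odd_primes Q).
  by rewrite ler_pdivrMr; lra.
have Eub : euler_product R (odd_primes Q) <= 8 / pi ^+ 2 + 2 / Q%:R.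
  have -> : 8 / pi ^+ 2 + 2 / Q%:R =
     (1 + Q%:R^-1) * (8 / pi ^+ 2) + Q%:R^-1 * (2 - 8 / pi ^+ 2) :> R by ring.
  have h1 : 0 <= Q%:R^-1 * (2 - 8 / pi ^+ 2) :> R.
    by rewrite mulr_ge0 ?invr_ge0 // subr_ge0 ler_pdivrMr; lra.
  have h2 : euler_product R (odd_primes Q) <= (1 + Q%:R^-1) * (8 / pi ^+ 2).
    rewrite mulrA ler_pdivlMr; last by lra.
    by lra.
  by lra.
have /andP[c0 c1] := c01.
near=> n.
have n0 : (0 < n)%N by near: n; exists 1%N.
have tail := sieve_tail Q3 M0 n0.
have mono : word_freq n (fun p => w p && odd_primitive p) <=
    word_freq n (fun p => w p && avoid (odd_primes Q) p).
  apply: word_freq_le => p /andP[-> /asboolP op] /=; apply/allP => q.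
  by rewrite mem_odd_primes => /andP[/op].
have : `|c * euler_product R (odd_primes Q) * 1%:R^-2 -
   word_freq n (fun p => w p && avoid (odd_primes Q) p && dvd_point 1 p)| <= e / 4.
  by near: n.
rewrite expr1n invr1 mulr1 (eq_word_freq _ (Q := fun p => w p && avoid (odd_primes Q) p));
    last first.
  by move=> p; rewrite /dvd_point !dvd1n /= andbT.
rewrite !ler_norml => /andP[l1 l2].
have cl := ler_wpM2l c0 Elb; have cu := ler_wpM2l c0 Eub.
have cQ : c * (2 / Q%:R) <= 2 / Q%:R by rewrite ler_piMl // divr_ge0.
by apply/andP; split; lra.
Unshelve. all: by end_near. Qed.

End Weighted.

End Sieve.

(** * Visible elements *)

Section Visible.
Variable R : realType.
Implicit Types (p : int * int).

Local Notation pos := (position letter_vector).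

Definition visible_pair p : bool := coprime `|p.1| `|p.2|.

(** A pair is coprime iff no prime divides both coordinates; the prime 2 is split off as a parity
    condition. *)
Lemma visible_pairE p :
  visible_pair p = (odd `|p.1| || odd `|p.2|) && odd_primitive p.
Proof.
case: p => x y; rewrite /visible_pair /=; apply/idP/andP => [xy|[oxy /asboolP op]].
  split.
    apply: contraTT xy; rewrite negb_or -!dvdn2 => /andP[x2 y2].
    by apply/negP => /(coprime_dvdl x2)/(coprime_dvdr y2).
  apply/asboolP => q /andP[pq _]; apply/negP => /andP[/= qx qy].
  have := coprime_dvdr qy (coprime_dvdl qx xy).
  by rewrite /coprime gcdnn => /eqP q1; rewrite q1 in pq.
rewrite /coprime; apply: contraT => g1.
have gx := dvdn_gcdl `|x| `|y|; have gy := dvdn_gcdr `|x| `|y|.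
have pp := pdiv_prime (_ : 1 < gcdn `|x| `|y|)%N.
have {}pp : prime (pdiv (gcdn `|x| `|y|)).
  apply: pp; rewrite ltn_neqAle eq_sym g1 gcdn_gt0.
  by apply/orP; case/orP: oxy => /odd_gt0; [left|right].
set q := pdiv _ in pp.
have qx : (q %| `|x|)%N by exact: dvdn_trans (pdiv_dvd _) gx.
have qy : (q %| `|y|)%N by exact: dvdn_trans (pdiv_dvd _) gy.
have [oq|] := boolP (odd q).
  by have := op q; rewrite /odd_prime pp oq /dvd_point /= qx qy => /(_ isT).
rewrite -dvdn2 dvdn_prime2 // => /eqP q2; rewrite -q2 in qx qy.
by move: oxy qx qy; rewrite !dvdn2 => /orP[] ->.
Qed.

(** Each letter moves exactly one coordinate, by 1 or -1. *)
Lemma odd_position s : odd `|(pos s).1| (+) odd `|(pos s).2| = odd (size s).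
Proof.
elim: s => [|x s IH]; first by rewrite /position big_nil.
rewrite position_cons /= -IH; case: x => i b; case: (pos s) => u v.
have odd1 (e z : int) : e = 1 \/ e = -1 -> odd `|e + z| = ~~ odd `|z|.
  by case=> ->; lia.
rewrite /letter_vector /=; case: ifP => _ /=; rewrite add0r odd1 ?addNb ?addbN //;
  by case: b; [left|right].
Qed.

Variables (F : groupType) (a : 'I_2 -> F) (alpha : F -> 'rV[int]_2).
Hypotheses (ha : free_basis a) (halpha : abelianization a alpha).

Lemma abelianization_eval s :
  alpha (eval_word a s) = \row_j (if j == ord0 then (pos s).1 else (pos s).2).
Proof.
have [alphaM alphaa] := halpha.
have alpha1 : alpha 1%g = 0.
  by apply: (addrI (alpha 1%g)); rewrite -alphaM mulg1 addr0.
have alphaV x : alpha x^-1%g = - alpha x.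
  by apply: (addrI (alpha x)); rewrite -alphaM mulgV alpha1 subrr.
elim: s => [|x s IH].
  rewrite /eval_word big_nil alpha1; apply/rowP => j.
  by rewrite !mxE /position big_nil /=; case: ifP.
rewrite eval_word_cons alphaM IH position_cons; apply/rowP => j.
rewrite !mxE; case: x => i b.
have -> : alpha (eval_letter a (i, b)) 0 j = (if b then 1 else -1) * (i == j)%:R.
  rewrite /eval_letter /=; case: b;
      rewrite ?alphaV alphaa !mxE eqxx /= ?mul1r ?mulN1r eq_sym //.
case: i j => [[|[|//]] ?] [[|[|//]] ?]; case: b;
    rewrite /letter_vector /= ?mulr1 ?mulr0 ?add0r //.
Qed.

Lemma visible_eval s : visible_point (alpha (eval_word a s)) <-> visible_pair (pos s).
Proof.
rewrite abelianization_eval /visible_point /visible_pair !mxE /= /gcdz /coprime.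
split=> [[_ /eqP]//|/eqP g]; split; last by rewrite g.
move=> /rowP v0; have := v0 0; have := v0 1; rewrite !mxE /= => e1 e0.
by move: g; rewrite e0 e1.
Qed.

Lemma gamma_count_word_freq n (X : set F) (P : pred (int * int)) :
  (forall s, s \in reduced_words 2 n.+1 -> X (eval_word a s) <-> P (pos s)) ->
  (gamma_count a n.+1 X)%:R / (gamma_count a n.+1 [set: F])%:R = word_freq R n P.
Proof.
move=> XP.
have count_sum (Y : set F) (Q : pred (int * int)) :
    (forall s, s \in reduced_words 2 n.+1 -> Y (eval_word a s) <-> Q (pos s)) ->
    (gamma_count a n.+1 Y)%:R = word_sum letter_vector n.+1 (fun p => (Q p)%:R : R).
  move=> YQ.
  rewrite (gamma_countE ha _ (reduced_words_uniq 2 n.+1) (mem_reduced_words n.+1)).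
  rewrite -sum1_count natr_sum big_mkcond big_seq [RHS]big_seq; apply: eq_bigr => s sr.
  by rewrite (asbool_equiv_eq (YQ s sr)) asboolb; case: (Q _).
rewrite (count_sum _ _ XP) (count_sum setT predT) //.
rewrite /word_freq /word_mean; congr (_ / _).
by rewrite -word_sum_const1; exact: eq_word_sum.
Qed.

(** Words of length n + 1 end in one parity class, on which [w] may replace the condition that some
    coordinate is odd. *)
Lemma gamma_visible_freq n (w : pred (int * int)) :
  (forall p, odd `|p.1| (+) odd `|p.2| = odd n.+1 ->
     odd `|p.1| || odd `|p.2| = w p) ->
  (gamma_count a n.+1 (visible_elements alpha))%:R
    / (gamma_count a n.+1 [set: F])%:R =
  word_freq R n (fun p => w p && odd_primitive p).
Proof.
move=> hw; apply: gamma_count_word_freq => s; rewrite mem_reduced_words => /andP[_ /eqP sn].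
rewrite /visible_elements /=; rewrite visible_eval visible_pairE.
by rewrite hw // odd_position sn.
Qed.

End Visible.

(* MathComp-Analysis *)
Theorem theorem3 (R : realType) (F : groupType) (a : 'I_2 -> F)
    (alpha : F -> 'rV[int]_2)
    (ha : free_basis a) (halpha : abelianization a alpha) :
  ((gamma_count a (2 * m)%N (visible_elements alpha))%:R
     / (gamma_count a (2 * m)%N [set: F])%:R : R) @[m --> \oo]
    --> 2 / (3 * zeta (2 : R))
  /\ 2 / (3 * zeta (2 : R)) = 4 / pi ^+ 2
  /\ ((gamma_count a (2 * m - 1)%N (visible_elements alpha))%:R
        / (gamma_count a (2 * m - 1)%N [set: F])%:R : R) @[m --> \oo]
       --> 8 / (pi : R) ^+ 2.
Proof.
have pi0 := pi_gt0 R.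
have pin0 : pi != 0 :> R by rewrite gt_eqF.
have zE : 2 / (3 * zeta (2 : R)) = 4 / pi ^+ 2.
  by rewrite zeta2E; move: (pi) pin0 => q q0; field.
split; last split => //; rewrite ?zE.
(* Even length: the coordinates have the same parity, so one of them is odd iff the first is. *)
- have lim : (fun n => word_freq R n (fun p => odd `|p.1| && odd_primitive p))
    @ \oo --> (4 / pi ^+ 2 : R).
    have -> : 4 / pi ^+ 2 = 2^-1 * (8 / pi ^+ 2) :> R.
      by move: (pi) pin0 => q q0; field.
    apply: cvg_freq_odd_primitive => [|d]; last exact: cvg_freq_odd_dvd.
    by apply/andP; split; lra.
  (* Passing to m + 1 skips length 0, which [word_freq] does not cover; length 2m + 2 has index 2m +
     1. *)
  rewrite -cvg_shiftS /=.
  have -> : (fun m => (gamma_count a (2 * m.+1) (visible_elements alpha))%:R /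
       (gamma_count a (2 * m.+1) [set: F])%:R : R) =
     (fun n => word_freq R n (fun p => odd `|p.1| && odd_primitive p))
         \o (fun m => 2 * m + 1)%N.
    apply/funext => m /=.
    have -> : (2 * m.+1 = (2 * m + 1).+1)%N by lia.
    apply: gamma_visible_freq => // p.
    have -> : odd (2 * m + 1).+1 = false by lia.
    by case: odd; case: odd.
  apply: cvg_comp lim.
  have h : (addn^~ 1%N \o muln 2) @ \oo --> \oo.
    by apply: (@cvg_comp _ _ _ _ _ _ \oo); [exact: cvg_mulnl|exact: cvg_addnr].
  exact: h.
(* Odd length: exactly one coordinate is odd, so parity imposes no condition. *)
- have lim : (fun n => word_freq R n (fun p => predT p && odd_primitive p))
    @ \oo --> (8 / pi ^+ 2 : R).
    rewrite -[X in _ --> X]mul1r.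
    apply: cvg_freq_odd_primitive => [|d od]; first by apply/andP; split; lra.
    by rewrite mul1r; exact: cvg_freq_dvd.
  (* The shift drops m = 0, where [2 * m - 1] is truncated to 0. *)
  rewrite -cvg_shiftS /=.
  have -> : (fun m => (gamma_count a (2 * m.+1 - 1) (visible_elements alpha))%:R /
       (gamma_count a (2 * m.+1 - 1) [set: F])%:R : R) =
     (fun n => word_freq R n (fun p => predT p && odd_primitive p)) \o muln 2.
    apply/funext => m /=.
    have -> : (2 * m.+1 - 1 = (2 * m).+1)%N by lia.
    apply: (gamma_visible_freq R ha halpha (w := predT)) => p.
    have -> : odd (2 * m).+1 = true by lia.
    by case: odd; case: odd.
  apply: cvg_comp lim; exact: cvg_mulnl.
Qed.
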